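(* Let $W:\mathcal{X}\to\mathcal{S}(B)$ be a cq-channel, $\widetilde{\mathcal{X}}=W(\mathcal{X})$ and $\sqrt{\widetilde{\mathcal{X}}}=\{\sqrt{\sigma}:\sigma\in\widetilde{\mathcal{X}}\}$. Then for any $\lambda_1,\lambda_2>0$ with $\lambda_1+\lambda_2<1$, \[ \frac14\,\overline{d}_M\!\left(\sqrt{\widetilde{\mathcal{X}}}\right)\le\dot{C}^{\rm opt}_{\rm DI}(W)\le\limsup_{n\to\infty}\frac{1}{n\log n}\log N_{\rm DI}(n,\lambda_1,\lambda_2)\le\frac12\,\overline{d}_M\!\left(\sqrt{\widetilde{\mathcal{X}}}\right). \] Similarly, for a quantum channel $\mathcal{N}:A\to B$ and a set $\mathcal{X}\subset\mathcal{S}(A)$ of allowed product-input states, with $\widetilde{\mathcal{X}}=\mathcal{N}(\mathcal{X})$: $\frac14\overline{d}_M(\sqrt{\widetilde{\mathcal{X}}})\le\dot{C}^{\rm opt}_{\rm DI}(\mathcal{N}|_{\mathcal{X}})\le\frac12\overline{d}_M(\sqrt{\widetilde{\mathcal{X}}})$.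
   Context: A cq-channel is a measurable map $W:\mathcal{X}\to\mathcal{S}(B)$ from a measure space to density operators on a finite-dimensional Hilbert space $B$; $W_{x^n}=W_{x_1}\otimes\cdots\otimes W_{x_n}$. An $(n,N,\lambda_1,\lambda_2)$-DI code for $W$ is $\{(u_j,E_j):j\in[N]\}$, $u_j\in\mathcal{X}^n$, $0\le E_j\le\mathbb{1}$ on $B^{\otimes n}$, with $\operatorname{Tr}W_{u_j}E_j\ge1-\lambda_1$ and $\operatorname{Tr}W_{u_j}E_k\le\lambda_2$ for all $j\neq k$; $N_{\rm DI}(n,\lambda_1,\lambda_2)$ is the largest such $N$. The optimistic slightly superlinear DI capacity is $\dot{C}^{\rm opt}_{\rm DI}(W)=\inf_{\lambda_1,\lambda_2>0}\limsup_{n\to\infty}\frac{1}{n\log n}\log N_{\rm DI}(n,\lambda_1,\lambda_2)$ (logs base 2). For a quantum channel, a DI $\mathcal{X}$-code uses product inputs $\rho_j=\rho_j^{(1)}\otimes\cdots\otimes\rho_j^{(n)}$ with $\rho_j^{(i)}\in\mathcal{X}$ and satisfies $\operatorname{Tr}\mathcal{N}^{\otimes n}(\rho_j)E_j\ge1-\lambda_1$, $\operatorname{Tr}\mathcal{N}^{\otimes n}(\rho_k)E_j\le\lambda_2$ for $j\ne k$; $\dot{C}^{\rm opt}_{\rm DI}(\mathcal{N}|_{\mathcal{X}})$ is defined analogously with $\limsup$. For a set $F$ of operators metrized by the Hilbert–Schmidt norm, $\Pi_\delta(F)$ is the maximal number of points of $F$ with pairwise distance at least $\delta$, and $\overline{d}_M(F)=\limsup_{\delta\to0}\frac{\log\Pi_\delta(F)}{-\log\delta}$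 is the upper Minkowski dimension. *)

(* Defs.v *)
From HB Require Import structures.
From mathcomp Require Import all_boot all_order all_algebra.
From mathcomp Require Import all_classical all_reals all_analysis.
From mathcomp Require Import complex mxtens.
Set Implicit Arguments. Unset Strict Implicit. Unset Printing Implicit Defensive.
Import Order.TTheory GRing.Theory Num.Theory.
Local Open Scope classical_set_scope.
Local Open Scope ring_scope.

Section QDefs.
Variable R : realType.
Local Notation C := (R[i]).

Definition adj m n (A : 'M[C]_(m, n)) : 'M[C]_(n, m) := (map_mx Num.conj A)^T.

(* positive semidefinite operator: Hermitian, and <v, A v> >= 0 for all v
   (0 <= z in C means z is a nonnegative real) *)
Definition psd n (A : 'M[C]_n) : Prop :=
  A = adj A /\ forall v : 'rV[C]_n, 0 <= (v *m A *m adj v) 0 0.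

Definition density n (A : 'M[C]_n) : Prop := psd A /\ \tr A = 1.

Definition hsnorm m n (A : 'M[C]_(m, n)) : R :=
  Num.sqrt (\sum_(i < m) \sum_(j < n) (complex.Re (A i j) ^+ 2 + complex.Im (A i j) ^+ 2)).

(* n-fold tensor product of d x d matrices; the basis of (C^d)^{(x)n} is
   indexed by {ffun 'I_n -> 'I_d}, enumerated as 'I_#|{ffun 'I_n -> 'I_d}| *)
Definition tidx (n d : nat) := #|{: {ffun 'I_n -> 'I_d}}|.

Definition tval (n d : nat) (i : 'I_(tidx n d)) : {ffun 'I_n -> 'I_d} := enum_val i.

Definition tens (n d : nat) (rho : n.-tuple 'M[C]_d) : 'M[C]_(tidx n d) :=
  \matrix_(i, j) \prod_(k < n)
     (tnth rho k) (tval i k) (tval j k).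

(* n-fold tensor power of a map Phi : M_dA -> M_dB (Phi assumed linear),
   defined through the matrix units: Phi^{(x)n}(M) = sum_{a,a'} M(a,a') (x)_k Phi(E_{a_k a'_k}) *)
Definition tens_map (n dA dB : nat) (Phi : 'M[C]_dA -> 'M[C]_dB)
    (M : 'M[C]_(tidx n dA)) : 'M[C]_(tidx n dB) :=
  \matrix_(b, b') \sum_(a < tidx n dA) \sum_(a' < tidx n dA)
     M a a' * \prod_(k < n)
        (Phi (delta_mx (tval a k) (tval a' k))) (tval b k) (tval b' k).

Definition log2 (x : R) : R := ln x / ln 2.
Definition elog2 (x : \bar R) : \bar R :=
  match x with
  | EFin r => if 0 < r then (log2 r)%:E else -oo%E
  | +oo%E => +oo%E
  | -oo%E => -oo%E
  end.

Definition srate (n : nat) (x : \bar R) : \bar R :=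
  (elog2 x * ((n%:R * log2 n%:R)^-1)%:E)%E.

Definition DIcode (X : Type) (d : nat) (W : X -> 'M[C]_d) (n N : nat) (l1 l2 : R)
    (u : 'I_N -> n.-tuple X) (E : 'I_N -> 'M[C]_(tidx n d)) : Prop :=
  (forall j, psd (E j) /\ psd (1%:M - E j)) /\
  (forall j, ((1 - l1)%:C <= \tr (tens (map_tuple W (u j)) *m E j))%C) /\
  (forall j k, j != k -> (\tr (tens (map_tuple W (u j)) *m E k) <= l2%:C)%C).

Definition NDI (X : Type) (d : nat) (W : X -> 'M[C]_d) (n : nat) (l1 l2 : R) : \bar R :=
  ereal_sup [set (N%:R)%:E | N in [set N | exists u E, @DIcode X d W n N l1 l2 u E]].

Definition limsupDI (X : Type) (d : nat) (W : X -> 'M[C]_d) (l1 l2 : R) : \bar R :=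
  limn_esup (fun n => srate n (NDI W n l1 l2)).

Definition CDIopt (X : Type) (d : nat) (W : X -> 'M[C]_d) : \bar R :=
  ereal_inf [set y | exists l1 l2 : R, 0 < l1 /\ 0 < l2 /\ y = limsupDI W l1 l2].

Definition DIcodeQ (dA dB : nat) (Phi : 'M[C]_dA -> 'M[C]_dB) (Xs : set 'M[C]_dA)
    (n N : nat) (l1 l2 : R) (rho : 'I_N -> n.-tuple 'M[C]_dA)
    (E : 'I_N -> 'M[C]_(tidx n dB)) : Prop :=
  (forall j (i : 'I_n), Xs (tnth (rho j) i)) /\
  (forall j, psd (E j) /\ psd (1%:M - E j)) /\
  (forall j, ((1 - l1)%:C <= \tr (tens_map Phi (tens (rho j)) *m E j))%C) /\
  (forall j k, j != k -> (\tr (tens_map Phi (tens (rho k)) *m E j) <= l2%:C)%C).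

Definition NDIQ (dA dB : nat) (Phi : 'M[C]_dA -> 'M[C]_dB) (Xs : set 'M[C]_dA)
    (n : nat) (l1 l2 : R) : \bar R :=
  ereal_sup [set (N%:R)%:E | N in
     [set N | exists rho E, @DIcodeQ dA dB Phi Xs n N l1 l2 rho E]].

Definition CDIoptQ (dA dB : nat) (Phi : 'M[C]_dA -> 'M[C]_dB) (Xs : set 'M[C]_dA) : \bar R :=
  ereal_inf [set y | exists l1 l2 : R, 0 < l1 /\ 0 < l2 /\
     y = limn_esup (fun n => srate n (NDIQ Phi Xs n l1 l2))].

Definition lin_map (dA dB : nat) (Phi : 'M[C]_dA -> 'M[C]_dB) : Prop :=
  forall (a : C) (A B : 'M[C]_dA), Phi (a *: A + B) = a *: Phi A + Phi B.

(* (id_k (x) Phi) applied to a block matrix M in M_k (x) M_dA *)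
Definition idtens (k dA dB : nat) (Phi : 'M[C]_dA -> 'M[C]_dB)
    (M : 'M[C]_(k * dA)) : 'M[C]_(k * dB) :=
  \matrix_(p, q)
    Phi (\matrix_(a, a') M (mxtens_index ((mxtens_unindex p).1, a))
                           (mxtens_index ((mxtens_unindex q).1, a')))
        (mxtens_unindex p).2 (mxtens_unindex q).2.

Definition CPTP (dA dB : nat) (Phi : 'M[C]_dA -> 'M[C]_dB) : Prop :=
  lin_map Phi /\
  (forall k (M : 'M[C]_(k * dA)), psd M -> psd (idtens Phi M)) /\
  (forall A, \tr (Phi A) = \tr A).

Definition packing (d : nat) (F : set 'M[C]_d) (delta : R) : \bar R :=
  ereal_sup [set ((size s)%:R)%:E | s in
    [set s : seq 'M[C]_d | uniq s /\ (forall A, A \in s -> F A) /\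
       pairwise (fun A B => delta <= hsnorm (A - B)) s]].

Definition dimM (d : nat) (F : set 'M[C]_d) : \bar R :=
  ereal_inf [set ereal_sup [set (elog2 (packing F delta) * ((- log2 delta)^-1)%:E)%E
                            | delta in [set delta | 0 < delta < eps]]
            | eps in [set eps : R | 0 < eps]].

Definition sqrtset (d : nat) (F : set 'M[C]_d) : set 'M[C]_d :=
  [set S | psd S /\ exists sigma, F sigma /\ S *m S = sigma].

End QDefs.

(* Main.v *)
Require Import Defs.
From HB Require Import structures.
From mathcomp Require Import all_boot all_order all_algebra.
From mathcomp Require Import all_classical all_reals all_analysis.
From mathcomp Require Import complex mxtens.
From mathcomp Require Import spectral ring lra.
Import Order.TTheory GRing.Theory Num.Theory.
Local Open Scope classical_set_scope.
Local Open Scope ring_scope.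

Set Implicit Arguments.
Unset Strict Implicit.
Unset Printing Implicit Defensive.

(* Converse: a test separating two product states with errors l1 + l2 < 1 keeps
   their (product) square roots at Hilbert-Schmidt distance bounded below, and the
   squared distance of the product square roots is at most the sum of the squared
   letter distances.  So covering the square roots of the letters at a scale of
   order n^(-1/2) separates the code words, whence N <= Pi^n at that scale.

   Achievability: use as letters a packing of the set of square roots at a scale of
   order n^(-1/4), as words a Gilbert-Varshamov code of words of almost equal
   entropy, and test the j-th word with the projection P_j on the entropy-typical
   part of the spectrum of rho_j.  On typical subspaces, with a = sqrt rho,
   rho_k <= exp(-h_k + O(sqrt n)) a_k and P_j <= exp(h_j + O(sqrt n)) a_j, so that
   tr(rho_k P_j) is at most a small atypical mass plus exp(O(sqrt n)) tr(a_k a_j);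
   the last trace is a product over the letters, at most exp(-c n delta^2).  This
   handles all k at once, although the number of words is superexponential in n. *)

(** * Spectral form of positive operators *)

Section Operators.
Variable R : realType.
Local Notation C := R[i].

Lemma adjK m n (A : 'M[C]_(m, n)) : adj (adj A) = A.
Proof. by apply/matrixP => i j; rewrite !mxE conjCK. Qed.

Lemma adj_mul m n p (A : 'M[C]_(m, n)) (B : 'M[C]_(n, p)) :
  adj (A *m B) = adj B *m adj A.
Proof. by rewrite /adj map_mxM trmx_mul. Qed.

Lemma adjB m n (A B : 'M[C]_(m, n)) : adj (A - B) = adj A - adj B.
Proof. by rewrite /adj map_mxB linearB. Qed.

Lemma adj1 n : adj (1%:M : 'M[C]_n) = 1%:M.
Proof. by rewrite /adj map_mx1 trmx1. Qed.

Lemma adjE m n (A : 'M[C]_(m, n)) : adj A = map_mx Num.conj A^T.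
Proof. by apply/matrixP => i j; rewrite !mxE. Qed.

Lemma trmx_conj_sandwich m n (X : 'M[C]_(m, n)) (E : 'M[C]_n) :
  \tr (X *m E *m adj X) = \sum_i (row i X *m E *m adj (row i X)) 0 0.
Proof.
rewrite /mxtrace; apply: eq_bigr => i _; rewrite !mxE.
apply: eq_bigr => k _; rewrite !mxE.
by congr (_ * _); apply: eq_bigr => l _; rewrite !mxE.
Qed.

Lemma psd_tr_ge0 m n (X : 'M[C]_(m, n)) (E : 'M[C]_n) :
  psd E -> 0 <= \tr (X *m E *m adj X).
Proof. by case=> _ h; rewrite trmx_conj_sandwich sumr_ge0. Qed.

Lemma psd1 n : psd (1%:M : 'M[C]_n).
Proof.
split=> [|v]; first by rewrite adj1.
rewrite mulmx1 mxE sumr_ge0 // => i _; rewrite !mxE.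
exact: mul_conjC_ge0.
Qed.

Lemma psd0 n : psd (0 : 'M[C]_n).
Proof.
split=> [|v]; first by apply/matrixP => i j; rewrite !mxE rmorph0.
by rewrite mulmx0 mul0mx mxE.
Qed.

Lemma hsnormE m n (A : 'M[C]_(m, n)) : (hsnorm A ^+ 2)%:C%C = \tr (A *m adj A).
Proof.
rewrite /hsnorm sqr_sqrtr; last first.
  by do 2![apply: sumr_ge0 => ? _]; rewrite addr_ge0 ?sqr_ge0.
rewrite rmorph_sum /mxtrace; apply: eq_bigr => i _; rewrite !mxE rmorph_sum.
by apply: eq_bigr => j _; rewrite !mxE -normCK -add_Re2_Im2.
Qed.

Lemma hsnorm_ge0 m n (A : 'M[C]_(m, n)) : 0 <= hsnorm A.
Proof. exact: sqrtr_ge0. Qed.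

(** Vectors are rows, so for unitary [U] the eigenvectors are the rows of [U]. Keeping basis and
    eigenvalues apart makes the form stable under tensor products. *)
Definition specmx n (U : 'M[C]_n) (a : 'I_n -> R) : 'M[C]_n :=
  adj U *m diag_mx (\row_i (a i)%:C%C) *m U.

Definition unitary n (U : 'M[C]_n) : Prop := U *m adj U = 1%:M.

Lemma unitaryC n (U : 'M[C]_n) : unitary U -> adj U *m U = 1%:M.
Proof. exact: mulmx1C. Qed.

Lemma adj_specmx n (U : 'M[C]_n) a : adj (specmx U a) = specmx U a.
Proof.
rewrite /specmx !adj_mul adjK mulmxA; congr (_ *m _ *m _).
apply/matrixP => i j; rewrite !mxE rmorphMn /= eq_sym.
by case: eqP => [->|]; rewrite ?mulr0n // !mulr1n; exact: conjc_real.
Qed.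

Lemma specmx_psd n (U : 'M[C]_n) a : (forall i, 0 <= a i) -> psd (specmx U a).
Proof.
move=> a0; split=> [|v]; first by rewrite adj_specmx.
rewrite (_ : _ *m _ = (v *m adj U *m diag_mx (\row_i (a i)%:C%C)) *m adj (v *m adj U)).
  rewrite mul_mx_diag mxE sumr_ge0 // => i _; rewrite !mxE mulrAC.
  by rewrite mulr_ge0 ?mul_conjC_ge0 // ler0c.
by rewrite adj_mul adjK !mulmxA.
Qed.

Lemma specmxM n (U : 'M[C]_n) a b : unitary U ->
  specmx U a *m specmx U b = specmx U (fun i => a i * b i).
Proof.
move=> hU; rewrite /specmx !mulmxA; congr (_ *m _).
rewrite -[_ *m U *m adj U]mulmxA hU mulmx1 -mulmxA; congr (_ *m _).
rewrite mulmx_diag; congr diag_mx; apply/rowP => i.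
by rewrite !mxE rmorphM.
Qed.

Lemma specmx1B n (U : 'M[C]_n) a : unitary U ->
  1%:M - specmx U a = specmx U (fun i => 1 - a i).
Proof.
move=> /unitaryC hU.
have -> : (1%:M : 'M[C]_n) = specmx U (fun=> 1).
  rewrite /specmx (_ : diag_mx _ = 1%:M) ?mulmx1 //.
  by apply/matrixP => i j; rewrite !mxE.
rewrite /specmx -mulmxBl -mulmxBr -raddfB /=; congr (_ *m _ *m _).
by congr diag_mx; apply/rowP => i; rewrite !mxE rmorphB.
Qed.

(** The squared modulus of the inner product of row [i] of [U] and row [j] of [V]: a transition
    probability between the two bases when both matrices are unitary. *)
Definition overlap n (U V : 'M[C]_n) (i j : 'I_n) : R :=
  let z := (U *m adj V) i j in complex.Re z ^+ 2 + complex.Im z ^+ 2.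

Lemma overlap_ge0 n (U V : 'M[C]_n) i j : 0 <= overlap U V i j.
Proof. by rewrite addr_ge0 ?sqr_ge0. Qed.

Lemma overlap_sum n (U V : 'M[C]_n) i : unitary U -> unitary V ->
  \sum_j overlap U V i j = 1.
Proof.
move=> hU hV; apply: (@complexI R); rewrite rmorph_sum.
transitivity (((U *m adj V) *m adj (U *m adj V)) i i).
  by rewrite mxE; apply: eq_bigr => j _; rewrite /= add_Re2_Im2 normCK !mxE.
rewrite adj_mul adjK mulmxA -(mulmxA U) unitaryC // mulmx1.
by rewrite hU mxE eqxx.
Qed.

(** Reduces a trace of operators that need not commute to a classical sum weighted by transition
    probabilities; the bound on false acceptance is proved on this sum. *)
Lemma tr_specmxM n (U V : 'M[C]_n) a b :
  \tr (specmx U a *m specmx V b) =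
  (\sum_i \sum_j a i * b j * overlap U V i j)%:C%C.
Proof.
have [M defM] : exists M, U *m adj V = M by exists (U *m adj V).
rewrite (_ : \tr _ = \tr (diag_mx (\row_i (a i)%:C%C) *m
    (M *m (diag_mx (\row_i (b i)%:C%C) *m adj M)))); last first.
  rewrite /specmx -defM adj_mul adjK -!mulmxA [LHS]mxtrace_mulC !mulmxA; exact: erefl.
rewrite rmorph_sum /mxtrace; apply: eq_bigr => i _.
rewrite mul_diag_mx !mxE rmorph_sum mulr_sumr; apply: eq_bigr => j _.
rewrite mul_diag_mx !mxE /overlap defM !rmorphM /= add_Re2_Im2 normCK.
by rewrite -[RHS]mulrA [X in _ = _ * X]mulrCA.
Qed.

Lemma psd_specP n (A : 'M[C]_n) : psd A ->
  exists (U : 'M[C]_n) (a : 'I_n -> R),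
    [/\ unitary U, forall i, 0 <= a i & A = specmx U a].
Proof.
move=> [hA pA].
have hn : A \is hermsymmx.
  by apply/is_hermitianmxP; rewrite expr0 scale1r -adjE.
have /orthomx_spectralP eA := hermitian_normalmx hn.
have uP := spectral_unitarymx A.
move: eA uP; set U := spectralmx A; set D := spectral_diag A => eA uP.
have hU : unitary U by rewrite /unitary adjE; apply/unitarymxP.
rewrite (invmx_unitary uP) -adjE in eA.
(* An eigenvalue is the quadratic form of [A] at the matching row of [U]. *)
have D0 i : 0 <= D 0 i.
  have := pA (row i U); rewrite eA.
  have -> : row i U *m (adj U *m diag_mx D *m U) *m adj (row i U)
          = row i (U *m (adj U *m diag_mx D *m U) *m adj U) *m delta_mx i 0.
    rewrite -colE -!row_mul; apply/matrixP => k l; rewrite !mxE.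
    by apply: eq_bigr => m _; rewrite !mxE; congr (_ * _); rewrite !mxE.
  rewrite !mulmxA hU mul1mx -mulmxA hU mulmx1 -colE !mxE eqxx mulr1n.
  by [].
exists U, (fun i => complex.Re (D 0 i)); split; first exact: hU.
  by move=> i; have := D0 i; rewrite lecE => /andP[].
rewrite eA /specmx; congr (_ *m _ *m _); congr diag_mx; apply/rowP => i.
by rewrite !mxE RRe_real // ger0_real.
Qed.

End Operators.

(** * Tensor products *)

Section Tensors.
Variable R : realType.
Local Notation C := R[i].

(** [tval] is a bijection from the tensor basis onto words, which lets products of sums be
    distributed. *)
Lemma sum_tidx (V : nmodType) n d (F : {ffun 'I_n -> 'I_d} -> V) :
  \sum_(i < tidx n d) F (Defs.tval i) = \sum_f F f.
Proof. by rewrite (reindex (@Defs.tval n d)) //; apply/onW_bij/enum_val_bij. Qed.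

Lemma tens_mul n d (A B : 'I_n -> 'M[C]_d) :
  tens [tuple A k | k < n] *m tens [tuple B k | k < n] =
  tens [tuple A k *m B k | k < n].
Proof.
apply/matrixP => i j; rewrite !mxE.
under [RHS]eq_bigr => k _ do rewrite tnth_mktuple mxE.
rewrite bigA_distr_bigA /= -(sum_tidx (fun f : {ffun 'I_n -> 'I_d} =>
  \prod_k (A k (Defs.tval i k) (f k) * B k (f k) (Defs.tval j k)))).
apply: eq_bigr => l _; rewrite !mxE -big_split; apply: eq_bigr => k _.
by rewrite !tnth_mktuple.
Qed.

Lemma tr_tens n d (A : 'I_n -> 'M[C]_d) :
  \tr (tens [tuple A k | k < n]) = \prod_k \tr (A k).
Proof.
rewrite /mxtrace bigA_distr_bigA -(sum_tidx (fun f : {ffun 'I_n -> 'I_d} =>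
  \prod_k A k (f k) (f k))).
apply: eq_bigr => i _; rewrite mxE; apply: eq_bigr => k _.
by rewrite tnth_mktuple.
Qed.

Lemma adj_tens n d (A : 'I_n -> 'M[C]_d) :
  adj (tens [tuple A k | k < n]) = tens [tuple adj (A k) | k < n].
Proof.
apply/matrixP => i j; rewrite !mxE rmorph_prod; apply: eq_bigr => k _.
by rewrite !tnth_mktuple !mxE.
Qed.

Lemma tens_diag n d (a : 'I_n -> 'I_d -> C) :
  tens [tuple diag_mx (\row_i a k i) | k < n] =
  diag_mx (\row_i \prod_k a k (Defs.tval i k)).
Proof.
apply/matrixP => i j; rewrite !mxE.
under [LHS]eq_bigr => k _ do rewrite tnth_mktuple !mxE.
case: eqP => [->|/eqP neij].
  by rewrite mulr1n; apply: eq_bigr => k _; rewrite eqxx mulr1n.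
have : Defs.tval i != Defs.tval j by apply: contra neij => /eqP /enum_val_inj ->.
rewrite mulr0n => /eqP /ffunP nij.
have [k nk] : exists k, Defs.tval i k != Defs.tval j k.
  by apply/existsP; apply: contra_notT nij => /existsPn h k; apply/eqP/negPn/h.
by rewrite (bigD1 k) //= (negPf nk) mulr0n mul0r.
Qed.

Lemma tens1 n d : tens [tuple (1%:M : 'M[C]_d) | _ < n] = 1%:M.
Proof.
have -> : (1%:M : 'M[C]_d) = diag_mx (\row_i 1).
  by apply/matrixP => i j; rewrite !mxE.
rewrite (tens_diag (fun _ _ => 1)).
by apply/matrixP => i j; rewrite !mxE big1.
Qed.

Lemma unitary_tens n d (U : 'I_n -> 'M[C]_d) : (forall k, unitary (U k)) ->
  unitary (tens [tuple U k | k < n]).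
Proof.
move=> hU; rewrite /unitary adj_tens tens_mul -[RHS]tens1; congr tens.
by apply: eq_mktuple => k; apply: hU.
Qed.

Lemma tens_specmx n d (U : 'I_n -> 'M[C]_d) (a : 'I_n -> 'I_d -> R) :
  tens [tuple specmx (U k) (a k) | k < n] =
  specmx (tens [tuple U k | k < n]) (fun i => \prod_k a k (Defs.tval i k)).
Proof.
rewrite /specmx adj_tens.
have -> : diag_mx (\row_i (\prod_k a k (Defs.tval i k))%:C%C) =
          tens [tuple diag_mx (\row_i (a k i)%:C%C) | k < n].
  rewrite (tens_diag (fun k i => (a k i)%:C%C)); congr diag_mx.
  by apply/rowP => i; rewrite !mxE rmorph_prod.
by rewrite !tens_mul.
Qed.

Lemma mxtraceB n (A B : 'M[C]_n) : \tr (A - B) = \tr A - \tr B.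
Proof. exact: raddfB. Qed.

(** The real part gives a value in [R]; on positive operators the trace is already real, by
    [psd_tr_mul]. *)
Definition hsip n (A B : 'M[C]_n) : R := complex.Re (\tr (A *m B)).

Lemma psd_tr_mul n (A B : 'M[C]_n) : psd A -> psd B ->
  0 <= hsip A B /\ \tr (A *m B) = (hsip A B)%:C%C.
Proof.
move=> /psd_specP [U [a [_ a0 ->]]] /psd_specP [V [b [_ b0 ->]]].
rewrite /hsip tr_specmxM /=; split=> //.
do 2!apply: sumr_ge0 => ? _; by rewrite !mulr_ge0 ?overlap_ge0.
Qed.

Lemma hsnormB_herm n (A B : 'M[C]_n) : adj A = A -> adj B = B ->
  (hsnorm (A - B) ^+ 2)%:C%C =
  \tr (A *m A) + \tr (B *m B) - \tr (A *m B) *+ 2.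
Proof.
move=> hA hB; rewrite hsnormE adjB hA hB mulmxBl !mulmxBr.
rewrite mxtraceB [X in X - _]mxtraceB [X in _ - X]mxtraceB (mxtrace_mulC B A).
by ring.
Qed.

Lemma hsnorm_psd n (A B : 'M[C]_n) : psd A -> psd B ->
  \tr (A *m A) = 1 -> \tr (B *m B) = 1 ->
  hsnorm (A - B) ^+ 2 = 2 - 2 * hsip A B.
Proof.
move=> pA pB tA tB; apply: (@complexI R).
rewrite hsnormB_herm -?pA.1 -?pB.1 // tA tB (psd_tr_mul pA pB).2.
by rewrite rmorphB rmorphM /= !rmorph_nat; ring.
Qed.

Lemma hsip_le1 n (A B : 'M[C]_n) : psd A -> psd B ->
  \tr (A *m A) = 1 -> \tr (B *m B) = 1 ->
  hsip A B = 1 - hsnorm (A - B) ^+ 2 / 2.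
Proof. by move=> pA pB tA tB; rewrite hsnorm_psd //; lra. Qed.

(** The Weierstrass product inequality; the bound by 1 feeds the induction. *)
Lemma prod_1B_ge (I : Type) (r : seq I) (x : I -> R) :
  (forall i, 0 <= x i <= 1) ->
  1 - \sum_(i <- r) x i <= \prod_(i <- r) (1 - x i) <= 1.
Proof.
move=> hx; elim: r => [|i r /andP[IH1 IH2]]; first by rewrite !big_nil subr0 lexx.
rewrite !big_cons; set s := \sum_(_ <- _) _ in IH1 *; set p := \prod_(_ <- _) _ in IH1 IH2 *.
have [/andP[x0 x1] p0] : 0 <= x i <= 1 /\ 0 <= p.
  by split=> //; apply: prodr_ge0 => j _; rewrite subr_ge0; case/andP: (hx j).
by apply/andP; split; nra.
Qed.

(** At unit norm, half the squared distance is 1 minus the inner product, and inner products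
    multiply under tensor products. The Weierstrass inequality then turns the product into a sum. *)
Lemma hsnorm_tens n d (A B : 'I_n -> 'M[C]_d) :
  (forall k, psd (A k)) -> (forall k, psd (B k)) ->
  (forall k, \tr (A k *m A k) = 1) -> (forall k, \tr (B k *m B k) = 1) ->
  hsnorm (tens [tuple A k | k < n] - tens [tuple B k | k < n]) ^+ 2 <=
  \sum_k hsnorm (A k - B k) ^+ 2.
Proof.
move=> pA pB tA tB.
set x := fun k => hsnorm (A k - B k) ^+ 2 / 2.
have ipE k : hsip (A k) (B k) = 1 - x k by rewrite hsip_le1.
have hx k : 0 <= x k <= 1.
  rewrite divr_ge0 ?sqr_ge0 //=.
  by have := (psd_tr_mul (pA k) (pB k)).1; rewrite ipE subr_ge0.
have trAB (X Y : 'I_n -> 'M[C]_d) :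
    \tr (tens [tuple X k | k < n] *m tens [tuple Y k | k < n]) =
    \prod_k \tr (X k *m Y k) by rewrite tens_mul tr_tens.
have hE : hsnorm (tens [tuple A k | k < n] - tens [tuple B k | k < n]) ^+ 2
    = 2 - 2 * \prod_k (1 - x k).
  have adjT (X : 'I_n -> 'M[C]_d) : (forall k, psd (X k)) ->
      adj (tens [tuple X k | k < n]) = tens [tuple X k | k < n].
    by move=> pX; rewrite adj_tens; congr tens; apply: eq_mktuple => k; rewrite -(pX k).1.
  apply: (@complexI R); rewrite hsnormB_herm ?adjT // !trAB.
  rewrite [\prod_k \tr (A k *m A k)]big1 // [\prod_k \tr (B k *m B k)]big1 //.
  have -> : \prod_k \tr (A k *m B k) = (\prod_k (1 - x k))%:C%C.
    rewrite rmorph_prod; apply: eq_bigr => k _.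
    by rewrite (psd_tr_mul (pA k) (pB k)).2 ipE.
  by rewrite rmorphB rmorphM /= !rmorph_nat; ring.
rewrite hE; have /andP[] := prod_1B_ge (index_enum 'I_n) hx.
by rewrite -mulr_suml; lra.
Qed.

Lemma le_Re (x y : C) : x <= y -> complex.Re x <= complex.Re y.
Proof. by rewrite lecE => /andP[]. Qed.

Lemma ReD (x y : C) : complex.Re (x + y) = complex.Re x + complex.Re y.
Proof. by case: x y => [? ?] []. Qed.

Lemma ReB (x y : C) : complex.Re (x - y) = complex.Re x - complex.Re y.
Proof. by case: x y => [? ?] []. Qed.

Lemma ReZ (a : R) (x : C) : complex.Re (a%:C%C * x) = a * complex.Re x.
Proof. by case: x => x y /=; rewrite mul0r subr0. Qed.

Lemma ReC (a : R) : complex.Re a%:C%C = a.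
Proof. by []. Qed.

Definition ReE := (ReB, ReD, ReZ, ReC).

(** With [D = A - B], the variables stand for [x = tr (B E B)], the cross terms [y] and [z],
    [w = tr (D E D)] and the squared norm [H] of [D]. Adding the second inequality to [t] times the
    acceptance bound cancels [y] and [z]. *)
Lemma peter_paul_real (l1 l2 t x y z w H : R) : t = 1 - l1 - l2 -> 0 < t ->
  0 <= H - w -> 0 <= t * (t * x) - t * y - (t * z - w) ->
  1 - l1 <= x + y + (z + w) -> x <= l2 ->
  t ^+ 2 * (1 - l2) / (1 + t) <= H.
Proof.
move=> tE t0 q1 q2 q3 q4.
rewrite ler_pdivrMr; last by rewrite addr_gt0.
have r1 : 0 <= (1 + t) * (H - w) by rewrite mulr_ge0 // addr_ge0 ?ler01 ?ltW.
have r3 : t * (1 - l1) <= t * (x + y + (z + w)) by rewrite ler_pM2l.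
have r4 : t * (1 + t) * x <= t * (1 + t) * l2.
  by rewrite ler_pM2l // mulr_gt0 // addr_gt0.
have -> : t ^+ 2 * (1 - l2) = t * (1 - l1) - t * (1 + t) * l2.
  by rewrite tE; ring.
lra.
Qed.

(* [tr (X E X)] is the square of a seminorm dominated by the Hilbert-Schmidt
   norm; the Peter-Paul form [|a|^2 <= (1 + t) |b|^2 + (1 + 1/t) |a - b|^2] is
   used at [t = 1 - l1 - l2]. *)
Lemma hsnorm_ge_of_test n (A B E : 'M[C]_n) (l1 l2 : R) :
  A = adj A -> B = adj B -> psd E -> psd (1%:M - E) ->
  0 < 1 - l1 - l2 ->
  ((1 - l1)%:C <= \tr (A *m A *m E))%C -> (\tr (B *m B *m E) <= l2%:C)%C ->
  (1 - l1 - l2) ^+ 2 * (1 - l2) / (1 + (1 - l1 - l2)) <= hsnorm (A - B) ^+ 2.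
Proof.
move=> hA hB pE pE1; set t := 1 - l1 - l2 => t0 h1 h2.
have [D defD] : exists D, A - B = D by exists (A - B).
rewrite defD; have hD : adj D = D by rewrite -defD adjB -hA -hB.
have AE : A = B + D by rewrite -defD addrC subrK.
have cyc X : \tr (X *m X *m E) = \tr (X *m E *m X) :> C.
  by rewrite -mulmxA mxtrace_mulC.
move: h1 h2; rewrite !cyc AE.
have e1 : adj (t%:C%C *: B - D) = t%:C%C *: B - D.
  rewrite adjB hD; congr (_ - _); rewrite {2}hB.
  by apply/matrixP => i j; rewrite !mxE rmorphM; congr (_ * _); exact: conjc_real.
(* Positivity of [E] at [t B - D] bounds the cross terms; that of [1 - E] at [D], below, bounds
   [tr (D E D)] by the squared norm of [D]. *)
have := psd_tr_ge0 (t%:C%C *: B - D) pE; rewrite e1.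
have -> : (t%:C%C *: B - D) *m E *m (t%:C%C *: B - D) =
    t%:C%C *: (t%:C%C *: (B *m E *m B)) - t%:C%C *: (B *m E *m D) -
    (t%:C%C *: (D *m E *m B) - D *m E *m D).
  by rewrite !mulmxBl !mulmxBr -!(scalemxAl, scalemxAr).
have := psd_tr_ge0 D pE1; rewrite hD.
have -> : D *m (1%:M - E) *m D = D *m D - D *m E *m D.
  by rewrite mulmxBr mulmxBl mulmx1.
have -> : (B + D) *m E *m (B + D) =
    B *m E *m B + B *m E *m D + (D *m E *m B + D *m E *m D).
  by rewrite !mulmxDl !mulmxDr.
rewrite !mxtraceB !mxtraceD !mxtraceZ.
rewrite -[X in \tr (D *m X)]hD -hsnormE.
move=> /le_Re q1 /le_Re q2 /le_Re q3 /le_Re q4.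
rewrite !ReE in q1 q2 q3 q4.
exact: (peter_paul_real (erefl _)) t0 q1 q2 q3 q4.
Qed.

End Tensors.

(** * Converse counting bound *)

Section Converse.
Variable R : realType.
Local Notation C := R[i].

Lemma psd_sqrt n (A : 'M[C]_n) : psd A -> exists S, psd S /\ S *m S = A.
Proof.
move=> /psd_specP [U [a [hU a0 ->]]].
exists (specmx U (fun i => Num.sqrt (a i))); split.
  by apply: specmx_psd => i; apply: sqrtr_ge0.
rewrite (specmxM _ _ hU); congr specmx; apply/funext => i.
by rewrite -expr2 sqr_sqrtr.
Qed.

Lemma sqr_hsnorm m n (A : 'M[C]_(m, n)) : hsnorm A ^+ 2 =
  \sum_i \sum_j (complex.Re (A i j) ^+ 2 + complex.Im (A i j) ^+ 2).
Proof.
rewrite sqr_sqrtr //.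
by do 2![apply: sumr_ge0 => ? _]; rewrite addr_ge0 ?sqr_ge0.
Qed.

Lemma hsnorm0 m n : hsnorm (0 : 'M[C]_(m, n)) = 0.
Proof.
apply/eqP; rewrite -sqrf_eq0 sqr_hsnorm big1 // => i _.
by rewrite big1 // => j _; rewrite mxE /= expr0n addr0.
Qed.

Lemma sqr_hsnormB_le m n (A B D : 'M[C]_(m, n)) :
  hsnorm (A - B) ^+ 2 <= 2 * hsnorm (A - D) ^+ 2 + 2 * hsnorm (B - D) ^+ 2.
Proof.
rewrite !sqr_hsnorm !mulr_sumr -big_split; apply: ler_sum => i _ /=.
rewrite !mulr_sumr -big_split; apply: ler_sum => j _; rewrite !mxE /=.
case: (A i j) (B i j) (D i j) => [a a'] [b b'] [e e'] /=.
have := sqr_ge0 (a + b - 2 * e); have := sqr_ge0 (a' + b' - 2 * e').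
lra.
Qed.

Lemma le_packing d (F : set 'M[C]_d) (delta : R) (s : seq 'M[C]_d) :
  uniq s -> (forall A, A \in s -> F A) ->
  pairwise (fun A B => delta <= hsnorm (A - B)) s ->
  ((size s)%:R%:E <= packing F delta)%E.
Proof. by move=> us Fs ps; apply: ereal_sup_ubound; exists s. Qed.

(** A packing of largest size is a cover, since an uncovered point could be added to it. The finite
    bound [M] makes a largest size exist. *)
Lemma packing_cover d (F : set 'M[C]_d) (delta M : R) : 0 < delta ->
  (packing F delta <= M%:E)%E ->
  exists s : seq 'M[C]_d, (size s)%:R <= M /\
    forall A, F A -> exists2 B, B \in s & hsnorm (A - B) < delta.
Proof.
move=> d0 hM.
pose ok (s : seq 'M[C]_d) := [/\ uniq s, (forall A, A \in s -> F A) &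
  pairwise (fun A B => delta <= hsnorm (A - B)) s].
pose P k := `[< exists2 s, ok s & size s = k >].
have okM s : ok s -> (size s)%:R <= M.
  by move=> [us Fs ps]; rewrite -lee_fin; apply: le_trans hM; apply: le_packing.
have ex0 : exists k, P k by exists 0%N; apply/asboolP; exists [::].
have ub k : P k -> (k <= Num.truncn M)%N.
  by move=> /asboolP [s /okM hs <-]; rewrite Num.Theory.truncn_ge_nat // (le_trans _ hs).
case: (ex_maxnP ex0 ub) => k /asboolP [s os sk] kmax.
exists s; split; first exact: okM.
move=> A FA; apply: contrapT => h.
have hd B : B \in s -> delta <= hsnorm (A - B).
  by move=> Bs; rewrite leNgt; apply/negP => ?; apply: h; exists B.
have : P k.+1.
  apply/asboolP; exists (A :: s); last by rewrite /= sk.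
  case: os => us Fs ps; split => /=.
  - rewrite us andbT; apply/negP => /hd.
    by rewrite subrr hsnorm0 leNgt d0.
  - by move=> B; rewrite inE => /orP[/eqP -> //|]; exact: Fs.
  - by rewrite ps andbT; apply/allP => B /hd.
by move=> /kmax; rewrite ltnn.
Qed.

(** The squared distance that a test forces in [hsnorm_ge_of_test]. *)
Definition test_gap (l1 l2 : R) : R :=
  (1 - l1 - l2) ^+ 2 * (1 - l2) / (1 + (1 - l1 - l2)).

Lemma test_gap_gt0 l1 l2 : 0 < l1 -> l1 + l2 < 1 -> 0 < test_gap l1 l2.
Proof.
move=> l10 l12; have ? : 0 < 1 - l1 - l2 by lra.
by rewrite divr_gt0 ?mulr_gt0 ?exprn_gt0 //; lra.
Qed.

(** Each code word is sent to the word of centres near its letters. Two code words with the same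
    image would have letter roots within [2 * delta], hence product roots at squared distance at
    most [4 * n * delta ^ 2], below the gap forced by the test. *)
Lemma DIcode_size_le (X : Type) d (W : X -> 'M[C]_d) n N (l1 l2 delta : R)
    (u : 'I_N -> n.-tuple X) (E : 'I_N -> 'M[C]_(tidx n d)) (s : seq 'M[C]_d) :
  (forall x, density (W x)) -> l1 + l2 < 1 -> DIcode W l1 l2 u E ->
  (forall A, sqrtset (range W) A -> exists2 B, B \in s & hsnorm (A - B) < delta) ->
  4 * n%:R * delta ^+ 2 < test_gap l1 l2 ->
  (N <= size s ^ n)%N.
Proof.
move=> dW l12 [pE [h1 h2]] cov hdelta.
have /choice [a ha] x : exists S, psd S /\ S *m S = W x.
  by apply: psd_sqrt; case: (dW x).
have /choice [c hc] x : exists k : 'I_(size s), hsnorm (a x - s`_k) < delta.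
  have [|B Bs hB] := cov (a x).
    by case: (ha x) => pa aa; split=> //; exists (W x); split=> //; exists x.
  have Bi : (index B s < size s)%N by rewrite index_mem.
  by exists (Ordinal Bi); rewrite /= nth_index.
pose f j : {ffun 'I_n -> 'I_(size s)} := [ffun i => c (tnth (u j) i)].
suff finj : injective f.
  by have := leq_card f finj; rewrite card_ord card_ffun !card_ord.
move=> j k /ffunP fjk; apply: contrapT => /eqP njk.
pose A j := tens [tuple a (tnth (u j) i) | i < n].
have AA i : tens (map_tuple W (u i)) = A i *m A i.
  rewrite tens_mul; congr tens; apply: eq_from_tnth => l.
  by rewrite tnth_map tnth_mktuple (ha _).2.
have hA i : A i = adj (A i).
  rewrite adj_tens; congr tens; apply: eq_mktuple => l.
  by rewrite -(ha _).1.1.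
have e0 : 0 < 1 - l1 - l2 by lra.
have h2' : (\tr (A k *m A k *m E j) <= l2%:C)%C.
  by rewrite -AA; apply: h2; rewrite eq_sym.
have h1' : ((1 - l1)%:C <= \tr (A j *m A j *m E j))%C by rewrite -AA.
have := hsnorm_ge_of_test (hA j) (hA k) (pE j).1 (pE j).2 e0 h1' h2'.
apply/negP; rewrite -ltNge; apply: le_lt_trans hdelta.
have tr1 i l : \tr (a (tnth (u i) l) *m a (tnth (u i) l)) = 1.
  by rewrite (ha _).2; case: (dW (tnth (u i) l)).
apply: (le_trans (hsnorm_tens _ _ (tr1 j) (tr1 k))) => [l|l|].
- by case: (ha (tnth (u j) l)).
- by case: (ha (tnth (u k) l)).
rewrite -mulrA mulrCA -[n in n%:R]card_ord mulr_natl -sumr_const.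
apply: ler_sum => l _.
have := fjk l; rewrite !ffunE => cjk.
apply: le_trans (sqr_hsnormB_le _ _ s`_(c (tnth (u j) l))) _.
have hj := hc (tnth (u j) l); have := hc (tnth (u k) l); rewrite -cjk => hk.
have sq y : 0 <= y -> y < delta -> y ^+ 2 <= delta ^+ 2.
  by move=> y0 yd; rewrite lerXn2r ?nnegrE ?(ltW yd) ?(ltW (le_lt_trans y0 yd)).
have := sq _ (hsnorm_ge0 _) hj; have := sq _ (hsnorm_ge0 _) hk.
lra.
Qed.

End Converse.

(** * Typical sets *)

Section Typicality.
Variable R : realType.

Lemma prod_if_eq n (i : 'I_n) (x : 'I_n -> R) :
  \prod_k (if k == i then x k else 1) = x i.
Proof. by rewrite -big_mkcond big_pred1_eq. Qed.

(** Under the product of the weights the [X k] are independent and centred, so only the diagonal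
    terms of the squared sum survive. *)
Lemma product_variance n d (w X : 'I_n -> 'I_d -> R) (v : R) :
  (forall k, \sum_b w k b = 1) -> (forall k, \sum_b w k b * X k b = 0) ->
  (forall k, \sum_b w k b * X k b ^+ 2 <= v) ->
  \sum_(f : {ffun 'I_n -> 'I_d})
     (\prod_k w k (f k)) * (\sum_k X k (f k)) ^+ 2 <= n%:R * v.
Proof.
move=> w1 X0 Xv.
pose g i k b := if k == i then X k b else 1.
have gE i j : \sum_(f : {ffun 'I_n -> 'I_d})
    (\prod_k w k (f k)) * (X i (f i) * X j (f j)) =
    \prod_k \sum_b w k b * (g i k b * g j k b).
  rewrite bigA_distr_bigA; apply: eq_bigr => f _.
  rewrite !big_split /=; congr (_ * (_ * _)).
    by rewrite (prod_if_eq i (fun k => X k (f k))).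
  by rewrite (prod_if_eq j (fun k => X k (f k))).
under eq_bigr => f _ do rewrite expr2 mulr_suml mulr_sumr.
rewrite exchange_big /= -[n in n%:R]card_ord mulr_natl -sumr_const.
apply: ler_sum => i _.
under eq_bigr => f _ do rewrite !mulr_sumr.
rewrite exchange_big /= (bigD1 i) //= [X in _ + X]big1 => [|j ji].
  rewrite addr0 gE (bigD1 i) //= [X in _ * X]big1 => [|k ki].
    rewrite mulr1 /g eqxx; apply: le_trans (Xv i).
    by apply: ler_sum => b _; rewrite -expr2.
  by rewrite -[RHS](w1 k); apply: eq_bigr => b _; rewrite /g (negPf ki) !mulr1.

rewrite gE (bigD1 j) //= [X in X * _](_ : _ = 0) ?mul0r //.
rewrite -[RHS](X0 j).
by apply: eq_bigr => b _; rewrite /g eqxx (negPf ji) mul1r.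
Qed.

(** Because [- ln s = ln (1 / s) < 1 / s]. This bounds the mean and second moment of [- ln s] under
    the weights [s ^ 2] uniformly, even for eigenvalues close to 0. *)
Lemma mul_oppln_itv (s : R) : 0 <= s <= 1 -> 0 <= s * - ln s <= 1.
Proof.
move=> /andP[s0 s1]; rewrite mulr_ge0 ?oppr_ge0 ?ln_le0 //=.
have [->|s_neq0] := eqVneq s 0; first by rewrite mul0r ler01.
have {}s0 : 0 < s by rewrite lt_def s_neq0.
rewrite -lnV ?posrE // -[leRHS](mulfV s_neq0) ler_pM2l // ltW //.
by rewrite ln_sublinear // invr_gt0.
Qed.

Section OneWord.
Variables (n d : nat) (s : 'I_n -> 'I_d -> R).
Hypothesis s_ge0 : forall k b, 0 <= s k b.
Hypothesis s_sum : forall k, \sum_b s k b ^+ 2 = 1.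

(* [s k] lists the square roots of the eigenvalues of the [k]-th letter, so that
   [logmean k] is half of its entropy. *)
Definition logmean k := \sum_b s k b ^+ 2 * - ln (s k b).

(** The first condition excludes vanishing factors, at which [ln] takes a default value. *)
Definition typical (tau : R) (f : {ffun 'I_n -> 'I_d}) : bool :=
  (0 < \prod_k s k (f k)) &&
  (`|\sum_k (- ln (s k (f k)) - logmean k)| <= tau).

Lemma s_itv k b : 0 <= s k b <= 1.
Proof.
rewrite s_ge0 /= -(@expr_le1 _ 2) // -(s_sum k) (bigD1 b) //= lerDl.
by apply: sumr_ge0 => i _; rewrite sqr_ge0.
Qed.

Lemma logmean_itv k : 0 <= logmean k <= d%:R.
Proof.
have h b : 0 <= s k b ^+ 2 * - ln (s k b) <= 1.
  have /andP[s0 s1] := s_itv k b; have /andP[l0 l1] := mul_oppln_itv (s_itv k b).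
  rewrite expr2 -mulrA mulr_ge0 //=; exact: mulr_ile1.
rewrite sumr_ge0 => [|b _]; last by case/andP: (h b).
rewrite -[d in d%:R]card_ord -[_%:R]mulr1n -mulr_natr mul1r -sum1_card natr_sum.
by apply: ler_sum => b _; case/andP: (h b).
Qed.

(** Chebyshev's inequality: the variance of a letter is at most its second moment, a sum of [d]
    terms each at most 1. *)
Lemma atypical_mass (tau : R) : 0 < tau ->
  \sum_(f | ~~ typical tau f) (\prod_k s k (f k)) ^+ 2 <= n%:R * d%:R / tau ^+ 2.
Proof.
move=> t0; pose X k b := - ln (s k b) - logmean k.
have := @product_variance n d (fun k b => s k b ^+ 2) X d%:R s_sum.
move=> /(_ _ _)/wrap[].
- move=> k; rewrite /X; under eq_bigr => b _ do rewrite mulrBr.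
  by rewrite big_split /= sumrN -mulr_suml s_sum mul1r subrr.
- move=> k; rewrite /X.
  have -> : \sum_b s k b ^+ 2 * (- ln (s k b) - logmean k) ^+ 2 =
      \sum_b (s k b * - ln (s k b)) ^+ 2 - logmean k ^+ 2.
    have e b : s k b ^+ 2 * (- ln (s k b) - logmean k) ^+ 2 =
      (s k b * - ln (s k b)) ^+ 2 - s k b ^+ 2 * - ln (s k b) * (logmean k *+ 2)
      + s k b ^+ 2 * logmean k ^+ 2 by ring.
    under eq_bigr => b _ do rewrite e.
    rewrite !big_split /= sumrN -!mulr_suml s_sum mul1r -/(logmean k); ring.
  rewrite lerBlDr (@le_trans _ _ d%:R) ?lerDl ?sqr_ge0 //.
  rewrite -[d in d%:R]card_ord -sum1_card natr_sum; apply: ler_sum => b _.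
  have /andP[l0 l1] := mul_oppln_itv (s_itv k b).
  by rewrite expr2 mulr_ile1.
rewrite ler_pdivlMr ?exprn_gt0 // => /(le_trans _); apply.
rewrite mulr_suml [leRHS](bigID (typical tau)) /= ler_wpDl //.
  apply: sumr_ge0 => f _; rewrite mulr_ge0 ?sqr_ge0 // prodr_ge0 // => k _.
  exact: sqr_ge0.
apply: ler_sum => f; rewrite /typical negb_and => /orP[|].
  (* Words of zero amplitude are atypical but carry no mass. *)
  rewrite -leNgt => s0; have -> : \prod_k s k (f k) = 0.
    by apply/eqP; rewrite eq_le s0 prodr_ge0.
  rewrite expr0n mul0r mulr_ge0 ?sqr_ge0 // prodr_ge0 // => k _.
  exact: sqr_ge0.
rewrite -ltNge -prodrXl => ht; rewrite ler_wpM2l ?prodr_ge0 // => [k _|].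
  exact: sqr_ge0.
rewrite -[leRHS]real_normK ?num_real //.
by rewrite lerXn2r ?nnegrE ?normr_ge0 ?ltW.
Qed.

Lemma typical_bounds (tau : R) f : typical tau f ->
  expR (- (\sum_k logmean k + tau)) <= \prod_k s k (f k) /\
  \prod_k s k (f k) <= expR (- (\sum_k logmean k - tau)).
Proof.
move=> /andP[p0]; have s0 k : 0 < s k (f k).
  rewrite lt_def s_ge0 andbT; apply: contraTneq p0 => e.
  by rewrite (bigD1 k) //= e mul0r ltxx.
have -> : \prod_k s k (f k) = expR (- \sum_k - ln (s k (f k))).
  rewrite sumrN opprK expR_sum; apply: eq_bigr => k _.
  by rewrite lnK ?posrE.
rewrite !ler_expR big_split /= !sumrN; set g := \sum_k ln _.
rewrite ler_norml => /andP[]; lra.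
Qed.

End OneWord.

(** The atypical rows are bounded by their whole mass, as the [q i] sum to 1. On the others, one
    factor [a i] is traded for [al] and the indicator of [T'] for [be * b j], which leaves the inner
    product of the two amplitude vectors. *)
Lemma test_error_le m (a b : 'I_m -> R) (T T' : pred 'I_m) (q : 'I_m -> 'I_m -> R)
    (al be : R) :
  (forall i, 0 <= a i) -> (forall i, 0 <= b i) -> (forall i j, 0 <= q i j) ->
  (forall i, \sum_j q i j = 1) -> 0 <= al -> 0 <= be ->
  (forall i, T i -> a i <= al) -> (forall j, T' j -> 1 <= be * b j) ->
  \sum_i \sum_j a i ^+ 2 * (T' j)%:R * q i j <=
  \sum_(i | ~~ T i) a i ^+ 2 + al * be * \sum_i \sum_j a i * b j * q i j.
Proof.
move=> a0 b0 q0 q1 al0 be0 Ta Tb.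
rewrite mulr_sumr (bigID T) /= addrC; apply: lerD.
  apply: ler_sum => i _; rewrite -[leRHS]mulr1 -[X in _ <= _ * X](q1 i) mulr_sumr.
  apply: ler_sum => j _; rewrite ler_wpM2r //.
  by case: (T' j); rewrite ?mulr1 ?mulr0 ?sqr_ge0.
rewrite [leRHS](bigID T) /= ler_wpDr //.
  apply: sumr_ge0 => i _; rewrite !mulr_ge0 // sumr_ge0 // => j _.
  by rewrite !mulr_ge0.
apply: ler_sum => i Ti; rewrite mulr_sumr; apply: ler_sum => j _.
rewrite mulrA ler_wpM2r //; case T'j: (T' j); last first.
  by rewrite /= mulr0 !mulr_ge0.
rewrite /= mulr1 (_ : al * be * _ = (a i * al) * (be * b j)); last by ring.
rewrite -[leLHS]mulr1 expr2; apply: ler_pM; rewrite ?mulr_ge0 //.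
  by rewrite ler_wpM2l // Ta.
exact: Tb.
Qed.

End Typicality.

(** * Separated sets of words *)

Section Separated.
Local Open Scope set_scope.
Local Open Scope nat_scope.

(** Greedy choice: keep a point, delete its neighbourhood of at most [V] points, and recurse. *)
Lemma separated_subset (T : finType) (e : rel T) (V : nat) :
  (forall x, e x x) -> (forall x, #|[set y | e x y]| <= V) ->
  forall S : {set T}, exists C : {set T}, [/\ C \subset S,
    {in C &, forall x y, x != y -> ~~ e x y || ~~ e y x} & (#|S| <= #|C| * V)].
Proof.
move=> er eV S; have [m] := ubnP #|S|; elim: m S => // m IH S; rewrite ltnS => Sm.
have [->|[x xS]] := finset.set_0Vmem S.
  by exists finset.set0; split; rewrite ?finset.sub0set ?cards0 // => x y; rewrite inE.
have [|C [CS sep cC]] := IH (S :\: [set y | e x y]).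
  apply: leq_trans Sm; apply: proper_card; apply/fintype.properP; split.
    exact: finset.subsetDl.
  by exists x => //; rewrite !inE er.
have xC : x \notin C.
  by apply/negP => /(fintype.subsetP CS); rewrite !inE er.
exists (x |: C); split.
- apply/fintype.subsetP => y; rewrite finset.in_setU1 => /orP[/eqP -> //|/(fintype.subsetP CS)].
  by rewrite inE => /andP[].
- move=> y z; rewrite !finset.in_setU1 => /orP[/eqP ->|yC] /orP[/eqP ->|zC].
  + by rewrite eqxx.
  + by move=> _; have := fintype.subsetP CS z zC; rewrite !inE => /andP[->].
  + by move=> _; have := fintype.subsetP CS y yC; rewrite !inE => /andP[->]; rewrite orbT.
  + exact: sep.
- rewrite cardsU1 xC mulSn -(cardsID [set y | e x y] S) leq_add //.
  by apply: leq_trans (eV x); apply: subset_leq_card; apply: finset.subsetIr.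
Qed.

Lemma pigeonhole_fiber (T U : finType) (g : T -> U) :
  (0 < #|U|) -> exists b, (#|T| <= #|[set y | g y == b]| * #|U|).
Proof.
move=> U0; apply: contrapT => /forallNP h.
have : (\sum_b #|[set y | g y == b]| * #|U| < #|U| * #|T|).
  rewrite -sum_nat_const; have /card_gt0P [b0 _] := U0.
  rewrite [ltnRHS](bigD1 b0) // [ltnLHS](bigD1 b0) //= -addSn leq_add //.
    by rewrite ltnNge; apply/negP/h.
  by apply: leq_sum => b _; rewrite ltnW // ltnNge; apply/negP/h.
rewrite -big_distrl /= mulnC ltnNge leq_pmul2l //; case/negP.
rewrite -sum1_card (partition_big g predT) //=; apply: leq_sum => b _.
by rewrite -sum1_card; under [leqRHS]eq_bigl => y do rewrite inE.
Qed.

Definition diffset n M (x y : {ffun 'I_n -> 'I_M}) : {set 'I_n} :=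
  [set k | x k != y k].

(** Words are counted by the set of positions where they differ from [x]. Bounding the number of
    these sets by [2 ^ n] is crude, but costs only a constant per letter while [ln M] grows. *)
Lemma hamming_ball n M r (x : {ffun 'I_n -> 'I_M}) : (0 < n) ->
  (#|[set y | #|diffset x y| <= r]| <= 2 ^ n * M ^ r).
Proof.
move=> n0; have M0 : (0 < M) by case: M x => // x; case: (x (Ordinal n0)).
rewrite -sum1_card (partition_big (diffset x) predT) //=.
have -> : 2 ^ n = #|{: {set 'I_n}}|.
  have := card_powerset [set: 'I_n]; rewrite finset.cardsT card_ord => <-.
  by apply: eq_card => D; rewrite !inE finset.subsetT.
rewrite -sum_nat_const; apply: leq_trans (_ : \sum_(D : {set 'I_n}) M ^ r <= _); last first.
  by under [leqRHS]eq_bigl => D do rewrite inE.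
apply: leq_sum => D _; rewrite sum1_card.
have [Dr|Dr] := leqP #|D| r; last first.
  rewrite (eq_card0 _) // => y; rewrite !inE; apply/negP => /andP[h /eqP e].
  by rewrite inE e leqNgt Dr in h.
apply: leq_trans (_ : M ^ #|D| <= _); last by rewrite leq_pexp2l.
(* A word that differs from [x] exactly on [D] is free on [D] and equals [x] elsewhere. *)
pose P k : pred 'I_M := if k \in D then predT else pred1 (x k).
apply: (@leq_trans #|family P|).
  apply: subset_leq_card; apply/fintype.subsetP => y; rewrite !inE => /andP[_ /eqP e].
  apply/familyP => k; rewrite /P; case: ifPn => // kD.
  by move: kD; rewrite -e !inE negbK eq_sym.
rewrite card_family /image_mem foldrE big_map big_enum /=.
rewrite (bigID [in D]) /= [X in (_ * X)]big1 ?muln1 => [|k kD]; last first.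
  by rewrite /P (negPf kD) card1.
under eq_bigr => k kD do rewrite /P kD card_ord.
by rewrite prod_nat_const.
Qed.

End Separated.

(** * Typical projections of words *)

Section Direct.
Variable R : realType.
Local Notation C := R[i].

Lemma tr_specmx n (U : 'M[C]_n) a : unitary U ->
  \tr (specmx U a) = (\sum_i a i)%:C%C.
Proof.
move=> hU; rewrite /specmx -mulmxA mxtrace_mulC -mulmxA hU mulmx1 mxtrace_diag.
by rewrite rmorph_sum; apply: eq_bigr => i _; rewrite mxE.
Qed.

Lemma hsip_tens n d (A B : 'I_n -> 'M[C]_d) :
  (forall k, psd (A k)) -> (forall k, psd (B k)) ->
  hsip (tens [tuple A k | k < n]) (tens [tuple B k | k < n]) =
  \prod_k hsip (A k) (B k).
Proof.
move=> pA pB; rewrite {1}/hsip tens_mul tr_tens.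
under eq_bigr => k _ do rewrite (psd_tr_mul (pA k) (pB k)).2.
by rewrite -(rmorph_prod (real_complex R)).
Qed.

Section Words.
Variables (n d M : nat) (S : 'I_M -> 'M[C]_d).
Variables (U : 'I_M -> 'M[C]_d) (s : 'I_M -> 'I_d -> R).
Hypothesis S_psd : forall b, psd (S b).
Hypothesis S_tr : forall b, \tr (S b *m S b) = 1.
Hypothesis U_unitary : forall b, unitary (U b).
Hypothesis s_ge0 : forall b i, 0 <= s b i.
Hypothesis S_spec : forall b, S b = specmx (U b) (s b).

Local Notation word := {ffun 'I_n -> 'I_M}.
Implicit Types y z : word.

Definition word_sqrt y : 'M[C]_(tidx n d) := tens [tuple S (y k) | k < n].
Definition word_basis y : 'M[C]_(tidx n d) := tens [tuple U (y k) | k < n].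
Definition word_amp y (i : 'I_(tidx n d)) : R :=
  \prod_k s (y k) (Defs.tval i k).
Definition word_typical tau y (i : 'I_(tidx n d)) : bool :=
  typical (fun k => s (y k)) tau (Defs.tval i).
Definition word_test tau y : 'M[C]_(tidx n d) :=
  specmx (word_basis y) (fun i => (word_typical tau y i)%:R).
Definition word_logmean y : R := \sum_k logmean (fun k => s (y k)) k.

Lemma s_sum1 b : \sum_i s b i ^+ 2 = 1.
Proof.
by apply: (@complexI R); apply: etrans (S_tr b); rewrite S_spec specmxM // tr_specmx.
Qed.

Lemma word_basis_unitary y : unitary (word_basis y).
Proof. exact: unitary_tens. Qed.

Lemma word_sqrt_spec y : word_sqrt y = specmx (word_basis y) (word_amp y).
Proof.
rewrite /word_basis /word_amp -(tens_specmx (fun k => U (y k)) (fun k => s (y k))).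
by congr tens; apply: eq_mktuple => k; exact: S_spec.
Qed.

Lemma word_test_psd tau y :
  psd (word_test tau y) /\ psd (1%:M - word_test tau y).
Proof.
split; first by apply: specmx_psd => i; exact: ler0n.
rewrite specmx1B; last exact: word_basis_unitary.
by apply: specmx_psd => i; rewrite subr_ge0; case: word_typical.
Qed.

Lemma word_atypical tau y : 0 < tau ->
  \sum_(i | ~~ word_typical tau y i) word_amp y i ^+ 2 <=
  n%:R * d%:R / tau ^+ 2.
Proof.
move=> t0; have := @atypical_mass R n d (fun k => s (y k)) (fun k b => s_ge0 (y k) b)
  (fun k => s_sum1 (y k)) tau t0.
apply: le_trans; rewrite le_eqVlt; apply/orP; left; apply/eqP.
rewrite [LHS]big_mkcond [RHS]big_mkcond; exact: (sum_tidx (fun f : {ffun 'I_n -> 'I_d} =>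
  if ~~ typical (fun k => s (y k)) tau f then
    (\prod_k s (y k) (f k)) ^+ 2 else 0)).
Qed.

Lemma word_amp_sum y : \sum_i word_amp y i ^+ 2 = 1.
Proof.
rewrite (sum_tidx (fun f : {ffun 'I_n -> 'I_d} => (\prod_k s (y k) (f k)) ^+ 2)).
under eq_bigr => f _ do rewrite -prodrXl.
rewrite -(bigA_distr_bigA (fun k b => s (y k) b ^+ 2)) big1 // => k _.
exact: s_sum1.
Qed.

Lemma word_test_accept tau y : 0 < tau ->
  ((1 - n%:R * d%:R / tau ^+ 2)%:C <=
   \tr (word_sqrt y *m word_sqrt y *m word_test tau y))%C.
Proof.
move=> t0; have hU := word_basis_unitary y.
rewrite word_sqrt_spec !specmxM // tr_specmx // lecR.
have := word_atypical y t0; have := word_amp_sum y.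
rewrite (bigID (word_typical tau y)) /=.
have -> : \sum_i word_amp y i * word_amp y i * (word_typical tau y i)%:R =
    \sum_(i | word_typical tau y i) word_amp y i ^+ 2.
  rewrite [RHS]big_mkcond; apply: eq_bigr => i _.
  by case: word_typical; rewrite ?mulr1 ?mulr0 ?expr2.
lra.
Qed.

Lemma word_test_reject tau y z : 0 < tau ->
  (\tr (word_sqrt y *m word_sqrt y *m word_test tau z) <=
   (n%:R * d%:R / tau ^+ 2 +
    expR (word_logmean z - word_logmean y + 2 * tau) *
    hsip (word_sqrt y) (word_sqrt z))%:C)%C.
Proof.
move=> t0; have hU := word_basis_unitary.
rewrite {1 2}word_sqrt_spec specmxM // tr_specmxM lecR.
have -> : hsip (word_sqrt y) (word_sqrt z) = \sum_i \sum_j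
    word_amp y i * word_amp z j * overlap (word_basis y) (word_basis z) i j.
  by rewrite /hsip !word_sqrt_spec tr_specmxM.
have amp0 x i : 0 <= word_amp x i by apply: prodr_ge0.
have bnd x i := @typical_bounds R n d (fun k => s (x k))
  (fun k b => s_ge0 (x k) b) tau (Defs.tval i).
have := @test_error_le R _ (word_amp y) (word_amp z) (word_typical tau y)
  (word_typical tau z) (overlap (word_basis y) (word_basis z))
  (expR (- (word_logmean y - tau))) (expR (word_logmean z + tau))
  (amp0 y) (amp0 z) (overlap_ge0 _ _).
move=> /(_ (fun i => overlap_sum i (hU y) (hU z)) (expR_ge0 _) (expR_ge0 _)).
move=> /(_ (fun i h => (bnd y i h).2)) h.
apply: le_trans (h _) _ => [j hj|].
  rewrite -[leLHS](expRxMexpNx_1 (word_logmean z + tau)) ler_pM2l ?expR_gt0 //.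
  exact: (bnd z j hj).1.
rewrite -expRD; apply: lerD; first exact: word_atypical.
by rewrite (_ : - _ + _ = word_logmean z - word_logmean y + 2 * tau) //; ring.
Qed.

End Words.

End Direct.

Section DirectCode.
Variable R : realType.
Local Notation C := R[i].

Lemma DIcode_exists (X : Type) d (W : X -> 'M[C]_d) n M q (l1 l2 delta c : R)
    (x : 'I_M -> X) (S : 'I_M -> 'M[C]_d) :
  (forall a, density (W a)) -> (forall b, psd (S b)) ->
  (forall b, S b *m S b = W (x b)) ->
  (forall b b', b != b' -> delta <= hsnorm (S b - S b')) ->
  (0 < n)%N -> (0 < q)%N -> 0 < c -> 0 < l2 -> 0 <= delta ->
  d%:R <= l1 * c ^+ 2 -> d%:R <= l2 / 2 * c ^+ 2 ->
  1 + 2 * c * Num.sqrt n%:R <= ln (l2 / 2) + n%:R * delta ^+ 2 / (2 * q%:R) ->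
  exists N u E, @DIcode R X d W n N l1 l2 u E /\
    (M ^ n <= N * (2 ^ n * M ^ (n %/ q)) * (n * d).+1)%N.
Proof.
move=> dW pS SW Sd n0 q0 c0 l20 delta0 dl1 dl2 hexp.
have trS b : \tr (S b *m S b) = 1 by rewrite SW; case: (dW (x b)).
have /choice [Us hUs] b : exists Us : 'M[C]_d * ('I_d -> R),
    [/\ unitary Us.1, forall i, 0 <= Us.2 i & S b = specmx Us.1 Us.2].
  by have [U [s h]] := psd_specP (pS b); exists (U, s).
pose U b := (Us b).1; pose s b := (Us b).2.
have hU b : unitary (U b) by case: (hUs b).
have s0 b i : 0 <= s b i by have [_ h _] := hUs b; exact: h.
have hS b : S b = specmx (U b) (s b) by case: (hUs b).
have n0R : 0 < n%:R :> R by rewrite ltr0n.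
have q0R : 0 < q%:R :> R by rewrite ltr0n.
pose tau := c * Num.sqrt n%:R.
have tau0 : 0 < tau by rewrite mulr_gt0 // sqrtr_gt0.
have tauE : n%:R * d%:R / tau ^+ 2 = d%:R / c ^+ 2.
  rewrite exprMn sqr_sqrtr ?ler0n //; field.
  by rewrite !gt_eqF.
have c20 : 0 < c ^+ 2 by rewrite exprn_gt0.
pose H (y : {ffun 'I_n -> 'I_M}) : R := word_logmean s y.
have H_itv y : 0 <= H y <= n%:R * d%:R.
  have hk k := @logmean_itv R n d (fun k => s (y k)) (fun k b => s0 (y k) b)
    (fun k => s_sum1 trS hU hS (y k)) k.
  rewrite sumr_ge0 => [|k _]; last by case/andP: (hk k).
  rewrite -[n in n%:R]card_ord mulr_natl -sumr_const.
  by apply: ler_sum => k _; case/andP: (hk k).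
have g_lt y : (Num.truncn (H y) < (n * d).+1)%N.
  case/andP: (H_itv y) => H0 H1.
  rewrite ltnS -(ler_nat R) natrM (le_trans _ H1) //.
  by rewrite Num.Theory.truncn_le.
pose g y := Ordinal (g_lt y).
have [|b] := @pigeonhole_fiber _ _ g; first by rewrite card_ord.
rewrite card_ffun !card_ord; set F := finset _ => cF.
pose e (y z : {ffun 'I_n -> 'I_M}) := (#|diffset y z| <= n %/ q)%N.
have diffC (y z : {ffun 'I_n -> 'I_M}) : diffset y z = diffset z y.
  by apply/setP => k; rewrite !inE eq_sym.
have e_refl y : e y y.
  by rewrite /e (_ : diffset y y = finset.set0) ?cards0 //; apply/setP => k; rewrite !inE eqxx.
have [K [KF sep cK]] := separated_subset e_refl (fun y => hamming_ball (n %/ q) y n0) F.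
pose w (j : 'I_#|K|) : {ffun 'I_n -> 'I_M} := enum_val j.
exists #|K|, (fun j => [tuple x (w j k) | k < n]),
  (fun j => word_test U s tau (w j)); split; last first.
  by apply: leq_trans cF _; rewrite leq_mul2r cK orbT.
have WE j : tens (map_tuple W [tuple x (w j k) | k < n]) =
    word_sqrt S (w j) *m word_sqrt S (w j).
  rewrite tens_mul; congr tens; apply: eq_from_tnth => k.
  by rewrite tnth_map !tnth_mktuple SW.
split; first by move=> j; apply: word_test_psd.
split=> [j|j k jk]; rewrite WE.
  apply: le_trans (word_test_accept trS hU s0 hS (w j) tau0).
  by rewrite lecR tauE lerD2l lerN2 ler_pdivrMr.
apply: le_trans (word_test_reject trS hU s0 hS (w j) (w k) tau0) _.
rewrite lecR tauE [leRHS](splitr l2); apply: lerD; first by rewrite ler_pdivrMr.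
have : w j != w k by apply: contra jk => /eqP /enum_val_inj ->.
move=> /(sep _ _ (enum_valP j) (enum_valP k)).
rewrite /e (diffC (w k)) orbb -ltnNge => hdiff.
have Hjk : H (w k) - H (w j) <= 1.
  have gE i : Num.truncn (H (w i)) = b :> nat.
    by have := fintype.subsetP KF _ (enum_valP i); rewrite inE => /eqP <-.
  have /andP[_] := Num.Theory.truncn_itv (proj1 (andP (H_itv (w k)))).
  have /andP[+ _] := Num.Theory.truncn_itv (proj1 (andP (H_itv (w j)))).
  by rewrite !gE -natr1; lra.
have ip : hsip (word_sqrt S (w j)) (word_sqrt S (w k)) <=
    expR (- (n%:R * delta ^+ 2 / (2 * q%:R))).
  rewrite hsip_tens // (@le_trans _ _ (expR (- \sum_i hsnorm (S (w j i) - S (w k i)) ^+ 2 / 2))) //.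
    rewrite -sumrN expR_sum; apply: ler_prod => i _.
    rewrite (psd_tr_mul (pS _) (pS _)).1 /= hsip_le1 //.
    exact: expR_ge1Dx.
  rewrite ler_expR lerN2.
  rewrite [leRHS](bigID (fun i => i \in diffset (w j) (w k))) /= ler_wpDr //.
    by apply: sumr_ge0 => i _; rewrite divr_ge0 ?sqr_ge0.
  apply: (@le_trans _ _ (\sum_(i in diffset (w j) (w k)) delta ^+ 2 / 2)).
    rewrite sumr_const -[leRHS]mulr_natl.
    have -> : n%:R * delta ^+ 2 / (2 * q%:R) = n%:R / q%:R * (delta ^+ 2 / 2).
      by field; rewrite gt_eqF.
    rewrite ler_wpM2r ?divr_ge0 ?sqr_ge0 // ler_pdivrMr // -natrM ler_nat.
    by rewrite ltnW // -ltn_divLR.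
  apply: ler_sum => i; rewrite inE => hi.
  rewrite ler_pM2r // lerXn2r ?nnegrE ?hsnorm_ge0 //.
  exact: Sd.
apply: le_trans (ler_wpM2l (expR_ge0 _) ip) _.
rewrite -expRD -[leRHS]lnK ?posrE ?divr_gt0 // ler_expR.
move: hexp Hjk; rewrite /tau mulrA -/(H (w j)) -/(H (w k)); lra.
Qed.

End DirectCode.

(** * Upper bound on the rate *)

Section Rates.
Variable R : realType.
Local Notation C := R[i].

Lemma ln2_gt0 : 0 < ln 2 :> R.
Proof. by rewrite ln_gt0 // ltr1n. Qed.

Lemma elog2_le (x : \bar R) (y : R) :
  (x <= (expR y)%:E)%E -> (elog2 x <= (y / ln 2)%:E)%E.
Proof.
case: x => [r| |] //=; last by move=> _; rewrite leNye.
rewrite lee_fin; case: ifP => [r0 h|_ _]; last by rewrite leNye.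
by rewrite lee_fin /log2 ler_pM2r ?invr_gt0 ?ln2_gt0 // -ler_expR lnK.
Qed.

Lemma le_elog2 (x : \bar R) (y : R) :
  ((expR y)%:E <= x)%E -> ((y / ln 2)%:E <= elog2 x)%E.
Proof.
case: x => [r| |] //=; last by move=> _; rewrite leey.
rewrite lee_fin => h; have r0 := lt_le_trans (expR_gt0 y) h.
by rewrite r0 lee_fin /log2 ler_pM2r ?invr_gt0 ?ln2_gt0 // -ler_expR lnK.
Qed.

Lemma elog2_le_inv (x : \bar R) (y : R) :
  (elog2 x <= (y / ln 2)%:E)%E -> (x <= (expR y)%:E)%E.
Proof.
case: x => [r| |] //=; last by move=> _; rewrite leNye.
rewrite lee_fin; case: ifPn => [r0|]; last first.
  by rewrite -leNgt => r0 _; apply: le_trans r0 (expR_ge0 _).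
by rewrite lee_fin /log2 ler_pM2r ?invr_gt0 ?ln2_gt0 // -ler_expR lnK.
Qed.

Lemma limn_esup_le (u : (\bar R)^nat) (x : \bar R) :
  (exists m, forall n, (m <= n)%N -> (u n <= x)%E) -> (limn_esup u <= x)%E.
Proof.
move=> [m h]; rewrite /limn_esup limf_esupE.
apply: (@le_trans _ _ (ereal_sup (u @` [set n | (m <= n)%N]))).
  by apply: ereal_inf_lbound; exists [set n | (m <= n)%N] => //; exact: nbhs_infty_ge.
by apply: ge_ereal_sup => _ [n /= mn <-]; exact: h.
Qed.

Lemma limn_esup_ge (u : (\bar R)^nat) (x : \bar R) :
  (forall m, exists2 n, (m <= n)%N & (x <= u n)%E) -> (x <= limn_esup u)%E.
Proof.
move=> h; rewrite /limn_esup limf_esupE; apply: le_ereal_inf_tmp => _ [V [m _ mV] <-].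
have [n mn xu] := h m; apply: le_trans xu _.
by apply: ereal_sup_ubound; exists n => //; exact: mV.
Qed.

Lemma srateE n (x : \bar R) :
  srate n x = (elog2 x * ((n%:R * ln n%:R / ln 2)^-1)%:E)%E.
Proof. by rewrite /srate /log2 mulrA. Qed.

Lemma nlnn_gt0 n : (1 < n)%N -> 0 < n%:R * ln n%:R / ln 2 :> R.
Proof.
move=> n1; rewrite divr_gt0 ?ln2_gt0 // mulr_gt0 ?ltr0n ?(ltnW n1) //.
by rewrite ln_gt0 // ltr1n.
Qed.

Lemma srate_le n (x : \bar R) (y : R) : (1 < n)%N ->
  (x <= (expR (n%:R * (y * ln n%:R)))%:E)%E -> (srate n x <= y%:E)%E.
Proof.
move=> n1 /elog2_le h; rewrite srateE lee_pdivrMr ?nlnn_gt0 //.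
by apply: le_trans h _; rewrite -EFinM lee_fin (_ : _ / _ = y * (n%:R * ln n%:R / ln 2)) //; ring.
Qed.

Lemma srate_ge n (x : \bar R) (y : R) : (1 < n)%N ->
  ((expR (n%:R * (y * ln n%:R)))%:E <= x)%E -> (y%:E <= srate n x)%E.
Proof.
move=> n1 /le_elog2 h; rewrite srateE lee_pdivlMr ?nlnn_gt0 //.
apply: le_trans h; rewrite -EFinM lee_fin.
by rewrite (_ : n%:R * (y * _) / _ = y * (n%:R * ln n%:R / ln 2)) //; ring.
Qed.

Lemma sqrtset_range_nonempty (X : Type) d (W : X -> 'M[C]_d) (a : X) :
  density (W a) -> exists S, sqrtset (range W) S.
Proof.
by move=> [/psd_sqrt [S [pS SW]] _]; exists S; split=> //; exists (W a); split=> //; exists a.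
Qed.

Lemma packing_ge1 d (F : set 'M[C]_d) (delta : R) : F !=set0 ->
  (1%:E <= packing F delta)%E.
Proof.
by move=> [A FA]; apply: (@le_packing _ _ _ _ [:: A]) => //= B; rewrite inE => /eqP ->.
Qed.

Lemma dimM_ge0 d (F : set 'M[C]_d) : F !=set0 -> (0 <= dimM F)%E.
Proof.
move=> F0; apply: le_ereal_inf_tmp => _ [eps eps0 <-].
pose m := Num.min eps 1; pose delta := m / 2.
have m0 : 0 < m by rewrite lt_min eps0 ltr01.
have m_eps : m <= eps by rewrite ge_min lexx.
have m1 : m <= 1 by rewrite ge_min lexx orbT.
have d0 : 0 < delta by rewrite divr_gt0.
have d1 : delta < 1 by rewrite /delta; lra.
have d_eps : delta < eps by rewrite /delta; lra.
apply: le_trans (ereal_sup_ubound _); last by exists delta => //=; rewrite d0.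
rewrite mule_ge0 ?lee_fin //.
  have := @le_elog2 (packing F delta) 0; rewrite mul0r expR0; apply.
  exact: packing_ge1.
by rewrite invr_ge0 oppr_ge0 mulr_le0_ge0 ?invr_ge0 ?ln_le0 ?(ltW d1) ?(ltW ln2_gt0).
Qed.

Section Upper.
Variables (X : Type) (d : nat) (W : X -> 'M[C]_d) (l1 l2 : R).
Hypothesis W_density : forall a, density (W a).
Hypotheses (l1_gt0 : 0 < l1) (l12 : l1 + l2 < 1).
Local Notation F := (sqrtset (range W)).

Lemma srate_NDI_le n (delta r : R) : (1 < n)%N -> 0 < delta < 1 ->
  (elog2 (packing F delta) * ((- log2 delta)^-1)%:E <= r%:E)%E ->
  4 * n%:R * delta ^+ 2 < test_gap l1 l2 ->
  (srate n (NDI W n l1 l2) <= (r * - ln delta / ln n%:R)%:E)%E.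
Proof.
move=> n1 /andP[d0 d1] hr hd.
have l0 : 0 < - log2 delta.
  by rewrite oppr_gt0 /log2 pmulr_llt0 ?invr_gt0 ?ln2_gt0 // ln_lt0 ?d0.
move: hr; rewrite lee_pdivrMr // -EFinM => hr.
have {hr} : (packing F delta <= (expR (r * - ln delta))%:E)%E.
  apply: elog2_le_inv; apply: le_trans hr _.
  by rewrite lee_fin /log2 -mulNr mulrA.
move=> /(packing_cover d0) [s [sM cov]].
apply: srate_le => //; rewrite divfK ?gt_eqF ?ln_gt0 ?ltr1n //.
apply: ge_ereal_sup => _ [N [u [E code]] <-]; rewrite lee_fin expRM_natl.
have := DIcode_size_le W_density l12 code cov hd.
rewrite -(ler_nat R) natrX => /le_trans; apply.
by rewrite lerXn2r ?nnegrE ?expR_ge0.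
Qed.

Lemma limsupDI_le_of_dimM (r r' : R) : 0 <= r -> r < r' ->
  (dimM F < r%:E)%E -> (limsupDI W l1 l2 <= (r' / 2)%:E)%E.
Proof.
move=> r0 rr' /ereal_inf_lt [_ [eps eps0 <-] hsup].
have [kap kapE] : exists kap, test_gap l1 l2 = kap by exists (test_gap l1 l2).
have kap0 : 0 < kap by rewrite -kapE test_gap_gt0.
pose B := r * - ln (kap / 8) / (r' - r).
pose e := Num.min eps 1; have e0 : 0 < e by rewrite lt_min eps0 ltr01.
pose m := (Num.truncn (expR B) + Num.truncn (kap / (8 * e ^+ 2)) + 2)%N.
apply: limn_esup_le; exists m => n mn.
have n1 : (1 < n)%N by apply: leq_trans mn; rewrite /m leq_addl.
have n0 : 0 < n%:R :> R by rewrite ltr0n ltnW.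
have lnn0 : 0 < ln n%:R :> R by rewrite ln_gt0 // ltr1n.
pose delta := Num.sqrt (kap / (8 * n%:R)).
have kn0 : 0 < kap / (8 * n%:R) by rewrite divr_gt0 // mulr_gt0.
have d0 : 0 < delta by rewrite sqrtr_gt0.
have dsq : delta ^+ 2 = kap / (8 * n%:R) by rewrite sqr_sqrtr // ltW.
have de : delta < e.
  rewrite -(@ltr_pXn2r _ 2) ?nnegrE ?(ltW d0) ?(ltW e0) // dsq ltr_pdivrMr ?mulr_gt0 //.
  have : kap / (8 * e ^+ 2) < n%:R.
    have ke : 0 < kap / (8 * e ^+ 2) by rewrite divr_gt0 // mulr_gt0 // exprn_gt0.
    rewrite -Num.Theory.truncn_lt_nat ?(ltW ke) //.
    by apply: leq_trans mn; rewrite /m -addnA ltn_addl // addn2 ltnS leqnSn.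
  rewrite ltr_pdivrMr ?mulr_gt0 ?exprn_gt0 //.
  by rewrite (_ : n%:R * (8 * e ^+ 2) = e ^+ 2 * (8 * n%:R)) //; ring.
have [deps d1] : delta < eps /\ delta < 1 by move: de; rewrite lt_min => /andP.
have lnd : - ln delta = (ln n%:R - ln (kap / 8)) / 2.
  have : ln (delta ^+ 2) = ln (kap / 8) - ln n%:R.
    by rewrite dsq invfM mulrA [LHS]ln_div ?posrE ?divr_gt0.
  by rewrite lnXn // mulr2n; lra.
have hn : B <= ln n%:R.
  rewrite -ler_expR lnK // ltW // -Num.Theory.truncn_lt_nat ?expR_ge0 //.
  by apply: leq_trans mn; rewrite /m addn2 ltnS -addnS leq_addr.
have rr : 0 < r' - r by rewrite subr_gt0.
apply: le_trans (@srate_NDI_le n delta r n1 _ _ _) _; rewrite ?d0 //.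
- apply: ltW; apply: le_lt_trans hsup; apply: ereal_sup_ubound.
  by exists delta => //=; rewrite d0.
- by rewrite dsq (_ : _ * _ = kap / 2) ?kapE; [lra|field; rewrite gt_eqF].
rewrite lee_fin ler_pdivrMr // lnd.
by move: hn; rewrite /B ler_pdivrMr //; lra.
Qed.

Lemma limsupDI_le : (exists a : X, True) ->
  (limsupDI W l1 l2 <= (1 / 2 : R)%:E * dimM F)%E.
Proof.
move=> [a _]; have F0 : F !=set0 by exact: sqrtset_range_nonempty (W_density a).
have := dimM_ge0 F0; move: (@limsupDI_le_of_dimM).
case: (dimM F) => [D| |] // h D0; last first.
  by rewrite gt0_muley ?leey // lte_fin; lra.
rewrite lee_fin in D0.
apply/lee_addgt0Pr => eps eps0; rewrite -EFinM -EFinD.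
have -> : 1 / 2 * D + eps = (D + 2 * eps) / 2 by lra.
by apply: (h (D + eps)); rewrite ?lte_fin; lra.
Qed.

End Upper.
End Rates.

(** * Lower bound on the rate *)

Section Lower.
Variable R : realType.
Local Notation C := R[i].

Lemma hsnormBC m n (A B : 'M[C]_(m, n)) : hsnorm (A - B) = hsnorm (B - A).
Proof.
congr Num.sqrt; apply: eq_bigr => i _; apply: eq_bigr => j _; rewrite !mxE.
by case: (A i j) (B i j) => [a a'] [b b'] /=; ring.
Qed.

Lemma packing_gt d (F : set 'M[C]_d) (delta M : R) : (M%:E < packing F delta)%E ->
  exists s : seq 'M[C]_d, [/\ uniq s, forall A, A \in s -> F A,
    pairwise (fun A B => delta <= hsnorm (A - B)) s & M < (size s)%:R].
Proof.
by move=> /ereal_sup_gt [_ [s [us [Fs ps]] <-]]; rewrite lte_fin => hM; exists s.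
Qed.

Lemma pairwise_nth_hsnorm d (delta : R) (s : seq 'M[C]_d) (b b' : 'I_(size s)) :
  pairwise (fun A B => delta <= hsnorm (A - B)) s -> b != b' ->
  delta <= hsnorm (s`_b - s`_b').
Proof.
move=> /(pairwiseP 0) h; wlog lt_bb' : b b' / (b < b')%N => [hw|_].
  case: (ltngtP b b') => [lt_bb'|lt_b'b|/val_inj ->]; last by rewrite eqxx.
  - exact: hw.
  - by move=> _; rewrite hsnormBC; apply: hw => //; rewrite neq_ltn lt_b'b.
exact: h (ltn_ord b) (ltn_ord b') lt_bb'.
Qed.

Lemma ln_natrX (a k : nat) : (0 < a)%N -> ln (a ^ k)%N%:R = k%:R * ln a%:R :> R.
Proof. by move=> a0; rewrite natrX lnXn ?ltr0n // mulr_natl. Qed.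

Lemma ln_counting (M N n e k : nat) : (0 < M)%N -> (0 < N)%N -> (0 < k)%N ->
  (M ^ n <= N * (2 ^ n * M ^ e) * k)%N ->
  n%:R * ln M%:R <=
  ln N%:R + (n%:R * ln 2 + e%:R * ln M%:R) + ln k%:R :> R.
Proof.
move=> M0 N0 k0; have pow0 a j : (0 < a)%N -> (0 < a ^ j)%N by rewrite expn_gt0 => ->.
rewrite -!ln_natrX // -!lnM ?posrE -?natrM ?ltr0n ?muln_gt0 ?M0 ?N0 ?k0 ?pow0 //.
by rewrite ler_ln ?posrE ?ltr0n ?muln_gt0 ?M0 ?N0 ?k0 ?pow0 // ler_nat.
Qed.

Lemma rate_arithmetic (nu kap lam r r1 l L ln_n ln_2 ln_N T P d : R) :
  0 < nu -> kap <= 1 -> 0 < r -> r1 * l <= lam ->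
  ln_n <= L + 4 * l -> 1 + d + r / 4 * L < ((1 - kap) * r1 - r) * l ->
  ln_2 <= 1 -> T <= nu * d -> P <= nu * (kap * lam) ->
  nu * lam <= ln_N + (nu * ln_2 + P) + T -> nu * (r / 4 * ln_n) <= ln_N.
Proof.
move=> nu0 k1 r0 hlam hn hB h2 hT hP hN.
have s1 : (1 - kap) * (r1 * l) <= (1 - kap) * lam by rewrite ler_wpM2l ?subr_ge0.
have s2 : r / 4 * ln_n <= r / 4 * (L + 4 * l) by rewrite ler_wpM2l // divr_ge0 // ltW.
have s3 : r / 4 * ln_n <= (1 - kap) * lam - 1 - d by lra.
have s4 : nu * (r / 4 * ln_n) <= nu * ((1 - kap) * lam - 1 - d) by rewrite ler_pM2l.
have s5 : nu * ln_2 <= nu * 1 by rewrite ler_pM2l.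
lra.
Qed.

Section Channel.
Variables (X : Type) (d : nat) (W : X -> 'M[C]_d) (l1 l2 : R).
Hypothesis W_density : forall a, density (W a).
Hypotheses (l1_gt0 : 0 < l1) (l2_gt0 : 0 < l2).
Local Notation F := (sqrtset (range W)).

Lemma NDI_ge n N u E : @DIcode R X d W n N l1 l2 u E ->
  (N%:R%:E <= NDI W n l1 l2)%E.
Proof. by move=> h; apply: ereal_sup_ubound; exists N => //; exists u, E. Qed.

Lemma NDI_ge1 n : (exists a : X, True) -> (1%:E <= NDI W n l1 l2)%E.
Proof.
move=> [a _]; apply: (@NDI_ge n 1 (fun=> [tuple a | _ < n]) (fun=> 1%:M)).
split; first by move=> _; rewrite subrr; split; [exact: psd1|exact: psd0].
split=> [j|j k]; last by rewrite !ord1.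
rewrite mulmx1 (_ : map_tuple _ _ = [tuple W a | _ < n]).
  rewrite tr_tens big1 => [|k _]; last by case: (W_density a).
  by rewrite -[leRHS]/(1%:C%C) lecR gerBl ltW.
by apply: eq_from_tnth => k; rewrite tnth_map !tnth_mktuple.
Qed.

Lemma limsupDI_ge0 : (exists a : X, True) -> (0 <= limsupDI W l1 l2)%E.
Proof.
move=> hX; apply: limn_esup_ge => m; exists m.+2; first by rewrite -addn2 leq_addr.
apply: srate_ge => //; rewrite mul0r mulr0 expR0; exact: NDI_ge1.
Qed.

(* With [r1 > r] below the dimension, words at Hamming distance [n / q] lose the
   factor [1 - 1/q] only; [n] is the least length with [sqrt n * delta^2 >= A], so
   that the squared distance [n delta^2 / q] beats the typicality slack of order
   [sqrt n]. *)
Lemma limsupDI_ge_of_dimM (r r1 : R) : 0 < r -> r < r1 ->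
  (r1%:E < dimM F)%E -> ((r / 4)%:E <= limsupDI W l1 l2)%E.
Proof.
move=> r0 rr1 hdim.
have r10 : 0 < r1 := lt_trans r0 rr1.
pose q := (Num.truncn (r1 / (r1 - r))).+1.
have q0 : 0 < q%:R :> R by rewrite ltr0n.
pose rho := (1 - q%:R^-1) * r1 - r.
have rho0 : 0 < rho.
  have hq : r1 / (r1 - r) < q%:R.
    by rewrite -Num.Theory.truncn_lt_nat // divr_ge0 ?subr_ge0 ?(ltW r10) ?(ltW rr1).
  have : r1 / q%:R < r1 - r.
    by move: hq; rewrite !ltr_pdivrMr ?subr_gt0 // mulrC.
  by rewrite /rho; lra.
pose c := 1 + d%:R / l1 + d%:R / (l2 / 2).
have l22 : 0 < l2 / 2 by rewrite divr_gt0.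
have cl1 : 0 <= d%:R / l1 by rewrite divr_ge0 ?ler0n ?ltW.
have cl2 : 0 <= d%:R / (l2 / 2) by rewrite divr_ge0 ?ler0n ?(ltW l22).
have c1 : 1 <= c by rewrite /c; lra.
have c0 : 0 < c by lra.
have cc : c <= c ^+ 2 by rewrite expr2 ler_peMr // ltW.
have dl1 : d%:R <= l1 * c ^+ 2.
  by rewrite -ler_pdivrMl // mulrC; apply: le_trans cc; rewrite /c; lra.
have dl2 : d%:R <= l2 / 2 * c ^+ 2.
  by rewrite -ler_pdivrMl // mulrC; apply: le_trans cc; rewrite /c; lra.
pose A0 := 1 + 2 * c + `|ln (l2 / 2)|.
have A01 : 1 <= A0 by have := normr_ge0 (ln (l2 / 2)); rewrite /A0; lra.
pose A := 2 * q%:R * A0.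
have A1 : 1 <= A.
  have q1 : 1 <= q%:R :> R by rewrite ler1n.
  by rewrite /A -[leLHS]mulr1 ler_pM //; lra.
have A20 : 1 <= A ^+ 2 by rewrite exprn_ege1.
pose B := 1 + d%:R + r / 4 * ln (2 * A ^+ 2).
apply: limn_esup_ge => m.
pose eps := Num.min (expR (- (B / rho))) (m.+2%:R^-1).
have eps0 : 0 < eps by rewrite lt_min expR_gt0 invr_gt0 ltr0n.
have : (r1%:E < ereal_sup [set (elog2 (packing F delta) * ((- log2 delta)^-1)%:E)%E
    | delta in [set delta | (0 < delta < eps)%R]])%E.
  by apply: lt_le_trans hdim _; apply: ereal_inf_lbound; exists eps.
move=> /ereal_sup_gt [_ [delta /= /andP[d0 deps] <-]].
have [dB dm] : delta < expR (- (B / rho)) /\ delta < m.+2%:R^-1.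
  by move: deps; rewrite lt_min => /andP.
have d1 : delta < 1.
  by apply: lt_le_trans dm _; rewrite invf_le1 ?ler1n ?ltr0n.
pose l := - ln delta.
have l0 : 0 < l by rewrite oppr_gt0 ln_lt0 ?d0.
have lB : B < rho * l.
  rewrite -ltr_pdivrMl // mulrC -ltr_expR /l expRN lnK ?posrE //.
  by rewrite -[ltLHS]invrK -expRN ltf_pV2 ?posrE ?expR_gt0.
have log0 : 0 < - log2 delta.
  by rewrite /log2 -mulNr mulr_gt0 ?invr_gt0 ?ln2_gt0.
rewrite lte_pdivlMr // => hpack.
have {hpack} : ((expR (r1 * l))%:E < packing F delta)%E.
  rewrite ltNge; apply/negP => /elog2_le; apply/negP; rewrite -ltNge.
  by rewrite (_ : _ / _ = r1 * - log2 delta) // /log2 /l; ring.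
move=> /packing_gt [s [us Fs ps hs]].
have lnM : r1 * l <= ln (size s)%:R.
  by rewrite -ler_expR lnK ?ltW // posrE (lt_trans (expR_gt0 _) hs).
have M0 : (0 < size s)%N by rewrite -(ltr_nat R) (lt_trans (expR_gt0 _) hs).
pose n := (Num.truncn (A ^+ 2 / delta ^+ 4)).+1.
have d40 : 0 < delta ^+ 4 by rewrite exprn_gt0.
have Ad0 : 0 <= A ^+ 2 / delta ^+ 4 by rewrite divr_ge0 ?sqr_ge0 // ltW.
have n_gt : A ^+ 2 / delta ^+ 4 < n%:R by rewrite -Num.Theory.truncn_lt_nat.
have Ad1 : delta^-1 <= A ^+ 2 / delta ^+ 4.
  rewrite -[leLHS]mul1r ler_pM ?invr_ge0 ?(ltW d0) //.
  by rewrite lef_pV2 ?posrE // exprS ler_piMr ?exprn_ile1 ?(ltW d0) ?(ltW d1).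
have n_le : n%:R <= 2 * A ^+ 2 / delta ^+ 4.
  have h1 : 1 <= A ^+ 2 / delta ^+ 4.
    by apply: le_trans Ad1; rewrite invf_ge1 // ltW.
  have : (Num.truncn (A ^+ 2 / delta ^+ 4))%:R <= A ^+ 2 / delta ^+ 4.
    by rewrite Num.Theory.truncn_le.
  by rewrite /n -natr1 -mulrA mulr_natl mulr2n => h2; exact: lerD h2 h1.
have mn : (m.+2 <= n)%N.
  rewrite -(ler_nat R) (le_trans _ (ltW n_gt)) // (le_trans _ Ad1) //.
  by rewrite -[leLHS]invrK lef_pV2 ?posrE ?invr_gt0 ?ltr0n // ltW.
have n1 : (1 < n)%N by apply: leq_trans mn.
have n0 : 0 < n%:R :> R by rewrite ltr0n ltnW.
exists n; first by apply: leq_trans mn; rewrite -addn2 leq_addr.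
have ln_n : ln n%:R <= ln (2 * A ^+ 2) + 4 * l.
  have h2 : 0 < 2 * A ^+ 2 by rewrite mulr_gt0 // (lt_le_trans ltr01).
  rewrite (_ : _ + _ = ln (2 * A ^+ 2 / delta ^+ 4)); last first.
    rewrite [RHS]ln_div ?posrE // lnXn // /l -mulr_natl; ring.
  by rewrite ler_ln ?posrE // divr_gt0.
have hexp : 1 + 2 * c * Num.sqrt n%:R <=
    ln (l2 / 2) + n%:R * delta ^+ 2 / (2 * q%:R).
  pose t : R := Num.sqrt n%:R.
  have tE : n%:R = t * t :> R by rewrite -expr2 sqr_sqrtr // ltW.
  have t1 : 1 <= t by rewrite -[1]sqrtr1 ler_wsqrtr // ler1n ltnW.
  have tA : A <= t * delta ^+ 2.
    have td0 : 0 <= t * delta ^+ 2 by rewrite mulr_ge0 ?sqr_ge0 ?sqrtr_ge0.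
    rewrite -(@ler_pXn2r _ 2) ?nnegrE ?(le_trans ler01 A1) //.
    rewrite [leRHS]exprMn -[t ^+ 2]/(t * t) -tE -exprM -ler_pdivrMr //; exact: ltW.
  have : A0 * t <= n%:R * delta ^+ 2 / (2 * q%:R).
    rewrite ler_pdivlMr ?mulr_gt0 // tE.
    rewrite (_ : A0 * t * (2 * q%:R) = t * A); last by rewrite /A; ring.
    by rewrite -mulrA ler_pM2l //; lra.
  have : `|ln (l2 / 2)| <= `|ln (l2 / 2)| * t by rewrite ler_peMr.
  have := ler_norm (- ln (l2 / 2)); rewrite normrN.
  rewrite -/t /A0; nra.
have /choice [x hx] (b : 'I_(size s)) : exists x : X, psd s`_b /\ s`_b *m s`_b = W x.
  by have [pS [_ [[x _ <-] hS]]] := Fs _ (mem_nth 0 (ltn_ord b)); exists x.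
have [N [u [E [code hN]]]] := @DIcode_exists R X d W n (size s) q l1 l2 delta c x
  (fun b => s`_b) W_density (fun b => (hx b).1) (fun b => (hx b).2)
  (fun b b' => pairwise_nth_hsnorm ps) (ltnW n1) (ltn0Sn _) c0 l2_gt0 (ltW d0)
  dl1 dl2 hexp.
apply: srate_ge => //; apply: le_trans (NDI_ge code); rewrite lee_fin.
have N0 : (0 < N)%N.
  rewrite lt0n; apply: contraTneq hN => ->; rewrite !mul0n -ltnNge.
  by rewrite expn_gt0 M0.
rewrite -[leRHS]lnK ?posrE ?ltr0n // ler_expR.
have := ln_counting M0 N0 (ltn0Sn _) hN.
have : (n %/ q)%:R * ln (size s)%:R <= n%:R / q%:R * ln (size s)%:R :> R.
  rewrite ler_wpM2r ?ln_ge0 ?ler1n // ler_pdivlMr // -natrM ler_nat.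
  exact: leq_trunc_div.
have : ln (n * d).+1%:R <= n%:R * d%:R :> R.
  rewrite -natr1 addrC natrM; apply: le_ln1Dx.
  by apply: lt_le_trans (mulr_ge0 (ler0n _ _) (ler0n _ _)); rewrite ltrN10.
have : ln 2 <= 1 :> R.
  by apply: le_trans (le_ln1Dx _) _ => //; rewrite -?natr1; lra.
move=> h1 h2 h3 h4.
have k1 : q%:R^-1 <= 1 :> R by rewrite invf_le1 ?ler1n ?ltr0n.
rewrite -[n%:R / _ * _]mulrA in h3.
exact: rate_arithmetic n0 k1 r0 lnM ln_n lB h1 h2 h3 h4.
Qed.

Lemma limsupDI_ge : (exists a : X, True) ->
  ((1 / 4 : R)%:E * dimM F <= limsupDI W l1 l2)%E.
Proof.
move=> hX; have := limsupDI_ge0 hX; move: limsupDI_ge_of_dimM.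
case: (limsupDI W l1 l2) => [L| |]; [|by move=> *; rewrite leey|by rewrite leeNy_eq].
rewrite lee_fin; case: (dimM F) => [D| |] h L0.
- rewrite -EFinM lee_fin leNgt; apply/negP => hD.
  have := h (4 * L + (D - 4 * L) / 3) (4 * L + (D - 4 * L) / 3 * 2).
  by rewrite lte_fin lee_fin => /(_ _ _ _)/wrap[]; lra.
- exfalso; have : (((4 * L + 1) / 4)%:E <= L%:E)%E
    by apply: (h _ (4 * L + 2)); rewrite ?ltry //; lra.
  by rewrite lee_fin; lra.
- have q0 : (0 < (1 / 4 : R)%:E)%E by rewrite lte_fin; lra.
  by rewrite gt0_muleNy // leNye.
Qed.

End Channel.
End Lower.

(** * Quantum channels *)

Section QuantumChannel.
Variable R : realType.
Local Notation C := R[i].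
Variables (dA dB : nat) (Phi : 'M[C]_dA -> 'M[C]_dB).

Lemma lin_mapE (A : 'M[C]_dA) : lin_map Phi ->
  Phi A = \sum_i \sum_j A i j *: Phi (delta_mx i j).
Proof.
move=> lin.
have Phi0 : Phi 0 = 0.
  by have := lin 1 0 0; rewrite !scale1r addr0 -[LHS]addr0 => /addrI <-.
have PhiD X Y : Phi (X + Y) = Phi X + Phi Y by have := lin 1 X Y; rewrite !scale1r.
have PhiZ a X : Phi (a *: X) = a *: Phi X.
  by have := lin a X 0; rewrite addr0 Phi0 addr0.
rewrite {1}[A]matrix_sum_delta (big_morph Phi PhiD Phi0).
apply: eq_bigr => i _; rewrite (big_morph Phi PhiD Phi0).
by apply: eq_bigr => j _; rewrite PhiZ.
Qed.

Lemma tens_map_tens n (rho : n.-tuple 'M[C]_dA) : lin_map Phi ->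
  tens_map Phi (tens rho) = tens (map_tuple Phi rho).
Proof.
move=> lin; apply/matrixP => b b'; rewrite !mxE.
pose G k (a a' : 'I_dA) : C := tnth rho k a a' *
  Phi (delta_mx a a') (Defs.tval b k) (Defs.tval b' k).
have -> : \prod_k tnth (map_tuple Phi rho) k (Defs.tval b k) (Defs.tval b' k) =
    \prod_k \sum_a \sum_a' G k a a'.
  apply: eq_bigr => k _; rewrite tnth_map [in LHS]lin_mapE // summxE.
  by apply: eq_bigr => a _; rewrite summxE; apply: eq_bigr => a' _; rewrite mxE.
rewrite bigA_distr_bigA /=.
rewrite -(sum_tidx (fun f : {ffun 'I_n -> 'I_dA} => \prod_k \sum_a' G k (f k) a')).
apply: eq_bigr => a _; rewrite bigA_distr_bigA /=.
rewrite -(sum_tidx (fun f : {ffun 'I_n -> 'I_dA} => \prod_k G k (Defs.tval a k) (f k))).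
by apply: eq_bigr => a' _; rewrite mxE -big_split.
Qed.

Lemma CPTP_psd (A : 'M[C]_dA) : CPTP Phi -> psd A -> psd (Phi A).
Proof.
move=> [_ [cp _]] [hA pA].
pose M : 'M[C]_(1 * dA) :=
  \matrix_(p, q) A (mxtens_unindex p).2 (mxtens_unindex q).2.
have idx1 m (p : 'I_(1 * m)) : mxtens_index (ord0, (mxtens_unindex p).2) = p.
  rewrite -[RHS]mxtens_unindexK; congr mxtens_index.
  by case: mxtens_unindex => i j; rewrite (ord1 i).
have sum1 m (f : 'I_(1 * m) -> C) : \sum_p f p = \sum_j f (mxtens_index (ord0, j)).
  rewrite (reindex (fun j : 'I_m => mxtens_index (ord0 : 'I_1, j))) //.
  exists (fun p => (mxtens_unindex p).2) => p _; last exact: idx1.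
  by rewrite mxtens_indexK.
have pM : psd M.
  split.
    by apply/matrixP => p q; rewrite !mxE [in LHS]hA !mxE.
  move=> v; have := pA (\row_j v 0 (mxtens_index (ord0, j))).
  congr (0 <= _); rewrite !mxE sum1; apply: eq_bigr => j _; rewrite !mxE sum1.
  by congr (_ * _); apply: eq_bigr => i _; rewrite !mxE !mxtens_indexK.
have eM p q : (idtens Phi M) p q = Phi A (mxtens_unindex p).2 (mxtens_unindex q).2.
  rewrite mxE; congr (Phi _ _ _); apply/matrixP => i j.
  by rewrite !mxE !mxtens_indexK.
have adj_coef m (B : 'M[C]_m) i j : adj B i j = Num.conj (B j i) by rewrite !mxE.
have [hP pP] := cp _ _ pM; split.
  apply/matrixP => i j.
  have /matrixP /(_ (mxtens_index (ord0, i)) (mxtens_index (ord0, j))) := hP.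
  by rewrite !adj_coef !eM !mxtens_indexK.
move=> v; have := pP (\row_p v 0 (mxtens_unindex p).2).
congr (0 <= _); rewrite !mxE sum1; apply: eq_bigr => j _.
rewrite !mxE mxtens_indexK sum1; congr (_ * _).
by apply: eq_bigr => i _; rewrite eM mxE !mxtens_indexK.
Qed.

Lemma CPTP_density (A : 'M[C]_dA) : CPTP Phi -> density A -> density (Phi A).
Proof.
by move=> cptp [pA tA]; split; [exact: CPTP_psd|rewrite cptp.2.2].
Qed.

Variable Xs : set 'M[C]_dA.

Definition restricted_channel (A : {A | Xs A}) : 'M[C]_dB := Phi (sval A).

Lemma range_restricted_channel : range restricted_channel = Phi @` Xs.
Proof.
apply/seteqP; split => [_ [[A XA] _ <-]|_ [A XA <-]]; first by exists A.
by exists (exist _ A XA).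
Qed.

Lemma NDIQ_restricted_channel n (l1 l2 : R) : lin_map Phi ->
  NDIQ Phi Xs n l1 l2 = NDI restricted_channel n l1 l2.
Proof.
move=> lin; congr (ereal_sup (image _ _)); apply/seteqP; split => N.
- move=> [rho [E [XR [pE [h1 h2]]]]].
  pose u j := [tuple exist Xs (tnth (rho j) i) (XR j i) | i < n].
  have uE j : tens (map_tuple restricted_channel (u j)) = tens_map Phi (tens (rho j)).
    rewrite tens_map_tens //; congr tens; apply: eq_from_tnth => i.
    by rewrite [LHS]tnth_map [RHS]tnth_map tnth_mktuple.
  exists u, E; split=> //; split=> [j|j k jk]; rewrite uE //.
  by apply: h2; rewrite eq_sym.
- move=> [u [E [pE [h1 h2]]]].
  pose rho j := map_tuple (fun A : {A | Xs A} => sval A) (u j).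
  have uE j : tens_map Phi (tens (rho j)) = tens (map_tuple restricted_channel (u j)).
    rewrite tens_map_tens //; congr tens; apply: eq_from_tnth => i.
    by rewrite !tnth_map.
  exists rho, E; split; first by move=> j i; rewrite tnth_map; exact: svalP.
  split=> //; split=> [j|j k jk]; rewrite uE //.
  by apply: h2; rewrite eq_sym.
Qed.

Lemma CDIoptQ_restricted_channel : lin_map Phi ->
  CDIoptQ Phi Xs = CDIopt restricted_channel.
Proof.
move=> lin; congr ereal_inf; apply/seteqP; split=> _ [l1 [l2 [h1 [h2 ->]]]];
  exists l1, l2; do 2!split=> //; congr limn_esup; apply/funext => n;
  by rewrite NDIQ_restricted_channel.
Qed.

End QuantumChannel.

Lemma dimM_le_CDIopt (R : realType) (X : Type) d (W : X -> 'M[R[i]]_d) :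
  (exists x : X, True) -> (forall x, density (W x)) ->
  ((1 / 4 : R)%:E * dimM (sqrtset (range W)) <= CDIopt W)%E.
Proof.
move=> hX dW; apply: le_ereal_inf_tmp => _ [l1 [l2 [h1 [h2 ->]]]].
exact: limsupDI_ge.
Qed.

Lemma CDIopt_le_limsupDI (R : realType) (X : Type) d (W : X -> 'M[R[i]]_d) (l1 l2 : R) :
  0 < l1 -> 0 < l2 -> (CDIopt W <= limsupDI W l1 l2)%E.
Proof. by move=> h1 h2; apply: ereal_inf_lbound; exists l1, l2. Qed.

Theorem theorem4 (R : realType) :
  (forall (d : nat) (X : Type) (W : X -> 'M[R[i]]_d),
     (exists x : X, True) ->
     (forall x, density (W x)) ->
     forall l1 l2 : R, 0 < l1 -> 0 < l2 -> l1 + l2 < 1 ->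
       ((1 / 4 : R)%:E * dimM (sqrtset (range W)) <= CDIopt W)%E /\
       (CDIopt W <= limsupDI W l1 l2)%E /\
       (limsupDI W l1 l2 <= (1 / 2 : R)%:E * dimM (sqrtset (range W)))%E) /\
  (forall (dA dB : nat) (Phi : 'M[R[i]]_dA -> 'M[R[i]]_dB) (Xs : set 'M[R[i]]_dA),
     CPTP Phi ->
     Xs !=set0 ->
     (forall rho, Xs rho -> density rho) ->
       ((1 / 4 : R)%:E * dimM (sqrtset (Phi @` Xs)) <= CDIoptQ Phi Xs)%E /\
       (CDIoptQ Phi Xs <= (1 / 2 : R)%:E * dimM (sqrtset (Phi @` Xs)))%E).
Proof.
split=> [d X W hX dW l1 l2 l10 l20 l12|dA dB Phi Xs cptp [A XA] dXs].
  by split; [exact: dimM_le_CDIopt|split; [exact: CDIopt_le_limsupDI|exact: limsupDI_le]].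
have dW a : density (restricted_channel Phi (Xs := Xs) a).
  by apply: CPTP_density => //; apply: dXs; exact: svalP.
have hX : exists a : {A | Xs A}, True by exists (exist _ A XA).
rewrite CDIoptQ_restricted_channel; last by case: cptp.
rewrite -range_restricted_channel; split; first exact: dimM_le_CDIopt.
have q0 : 0 < 1 / 4 :> R by lra.
apply: le_trans (CDIopt_le_limsupDI _ q0 q0) _.
by apply: limsupDI_le => //; lra.
Qed.
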